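(* Let $(P_1,Q_1)\neq(P_2,Q_2)$ be non-degenerate integer pairs with $P_i>0$ and $|Q_i|=1$ ($i=1,2$), and let $D_i=P_i^2-4Q_i$. The intersection $\{V_n(P_1,Q_1):n\ge0\}\cap\{V_n(P_2,Q_2):n\ge0\}$ is infinite if and only if $D_1D_2$ is a perfect square. Moreover, in that case there exist integers $P'>0$ and $Q'$ with $|Q'|=1$ such that this intersection equals $\{V_n(P',Q'):n\ge0\}$.
   Context: For integers $P,Q$, the Lucas sequences are defined by $U_0(P,Q)=0$, $U_1(P,Q)=1$, $V_0(P,Q)=2$, $V_1(P,Q)=P$, and for $n\ge1$: $U_{n+1}=P\,U_n-Q\,U_{n-1}$, $V_{n+1}=P\,V_n-Q\,V_{n-1}$. The discriminant of $(P,Q)$ is $P^2-4Q$. A pair $(P,Q)$ (and its sequences) is called degenerate if $(P,Q)\in\{(0,1),(0,-1),(1,1),(2,1)\}$, and non-degenerate otherwise. *)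

(* Defs.v *)
From Stdlib Require Import ZArith List.
Open Scope Z_scope.

Fixpoint lucasV (P Q : Z) (n : nat) : Z :=
  match n with
  | O => 2
  | S m =>
    match m with
    | O => P
    | S k => P * lucasV P Q m - Q * lucasV P Q k
    end
  end.

Definition discr (P Q : Z) : Z := P * P - 4 * Q.

Definition degenerate (P Q : Z) : Prop :=
  (P, Q) = (0, 1) \/ (P, Q) = (0, -1) \/ (P, Q) = (1, 1) \/ (P, Q) = (2, 1).

Definition inV (P Q x : Z) : Prop := exists n : nat, lucasV P Q n = x.

Definition finite_Zset (S : Z -> Prop) : Prop :=
  exists l : list Z, forall x, S x -> In x l.

Definition infinite_Zset (S : Z -> Prop) : Prop := ~ finite_Zset S.

Definition is_square (z : Z) : Prop := exists k : Z, z = k * k.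

(* Main.v *)
Require Import Defs.
From Stdlib Require Import ZArith List.
From Stdlib Require Import Reals Lra Lia Classical FinFun.
From Stdlib Require Import FunctionalExtensionality.
From Coquelicot Require Import Coquelicot.

(* If [D1 D2] is a square, Pell descent shows that the indices [n] with [V_n(P1, Q1)] in the second
   sequence are (apart from the value [2]) those for which [D2] divides [sqrt (D1 D2) U_n] and the
   signs agree; they are the multiples of the least positive one, [i], and then
   [P' = V_i], [Q' = Q1 ^ i].

   If [D1 D2] is not a square, a common value [x > 2] with [Q1 ^ n = Q2 ^ m = e] is impossible, since
   [(x^2 - 4 e)^2 = D1 D2 (y z)^2]. With opposite signs, [x^2 - D1 y^2 = 4] and [x^2 - D2 z^2 = -4].
   Comparing [n log alpha] with [m log beta] for two such values [x0 < x] forces [x] to be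
   exponentially large in [x0^2], hence [x >= x0 ^ 16] once [x0] is large. On the other hand,
   [sqrt (1 - 4 / x0^2)] and [sqrt (1 + 4 / x0^2)] equal [y0 sqrt D1 / x0] and [z0 sqrt D2 / x0], so
   [x] yields pade_form simultaneous rational approximations to them, with denominator [x x0]. Small
   linear forms [L = A + B sqrt (1 - z) + C sqrt (1 + z)] at [z = 4 / x0^2], obtained as divided
   differences of [w -> (1 + w z) ^ (K + 1/2)] at the nodes [0, 1, -1] of multiplicity [K + 1]
   (Rickert's simultaneous Padé approximants), exclude this when [x >= x0 ^ 16]. The power series of
   [L] has terms of constant sign, which gives the lower bound on [L] that replaces the usual
   non-vanishing determinant. *)

Open Scope Z_scope.

(** * Lucas sequences and Pell equations *)

(** For [P > 0] and [|Q| = 1] this is non-degeneracy, split by the sign of [Q] because the estimates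
    differ in the two cases. *)
Definition regular (P Q : Z) : Prop := (Q = 1 /\ 3 <= P) \/ (Q = -1 /\ 1 <= P).

Lemma regular_of_nondegenerate (P Q : Z) :
  ~ degenerate P Q -> 0 < P -> Z.abs Q = 1 -> regular P Q.
Proof.
  unfold degenerate, regular; intros Hd HP HQ.
  assert (Q = 1 \/ Q = -1) as [-> | ->] by lia; [left | right; lia].
  assert (P <> 1) by (intros ->; tauto).
  assert (P <> 2) by (intros ->; tauto). lia.
Qed.

Lemma regular_sq (P Q : Z) : regular P Q -> Q * Q = 1.
Proof. intros [[-> _] | [-> _]]; reflexivity. Qed.

Lemma regular_discr (P Q : Z) : regular P Q -> 0 < discr P Q.
Proof. unfold discr; intros [[-> ?] | [-> ?]]; nia. Qed.

Fixpoint lucasU (P Q : Z) (n : nat) : Z :=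
  match n with
  | O => 0
  | S m =>
    match m with
    | O => 1
    | S k => P * lucasU P Q m - Q * lucasU P Q k
    end
  end.

Lemma lucasU_SS (P Q : Z) (n : nat) :
  lucasU P Q (S (S n)) = P * lucasU P Q (S n) - Q * lucasU P Q n.
Proof. reflexivity. Qed.

Lemma lucasV_SS (P Q : Z) (n : nat) :
  lucasV P Q (S (S n)) = P * lucasV P Q (S n) - Q * lucasV P Q n.
Proof. reflexivity. Qed.

Lemma two_step_ind (A : nat -> Prop) :
  A 0%nat -> A 1%nat -> (forall n, A n -> A (S n) -> A (S (S n))) -> forall n, A n.
Proof.
  intros H0 H1 HS n. enough (A n /\ A (S n)) by tauto.
  induction n; split; try tauto. now apply HS.
Qed.

Lemma lucasV_lucasU (P Q : Z) (n : nat) :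
  lucasV P Q n = 2 * lucasU P Q (S n) - P * lucasU P Q n.
Proof.
  induction n as [| | n IH1 IH2] using two_step_ind; [cbn [lucasU lucasV]; ring .. |].
  rewrite lucasV_SS, IH1, IH2, !lucasU_SS. ring.
Qed.

Lemma pow_S (Q : Z) (n : nat) : Q ^ Z.of_nat (S n) = Q * Q ^ Z.of_nat n.
Proof. rewrite Nat2Z.inj_succ, Z.pow_succ_r; lia. Qed.

(** With [a], [b] the roots of [X^2 - P X + Q], the left side factors as [(U_(n+1) - a U_n) (U_(n+1)
    - b U_n) = b^n a^n]. *)
Lemma lucasU_quadratic (P Q : Z) (n : nat) :
  lucasU P Q (S n) * lucasU P Q (S n) - P * lucasU P Q n * lucasU P Q (S n)
  + Q * lucasU P Q n * lucasU P Q n = Q ^ Z.of_nat n.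
Proof.
  induction n; [cbn [lucasU]; change (Q ^ Z.of_nat 0) with 1; ring |].
  rewrite pow_S, <- IHn, lucasU_SS. ring.
Qed.

Lemma lucas_pell (P Q : Z) (n : nat) :
  lucasV P Q n * lucasV P Q n - discr P Q * (lucasU P Q n * lucasU P Q n)
  = 4 * Q ^ Z.of_nat n.
Proof. rewrite <- (lucasU_quadratic P Q n), lucasV_lucasU. unfold discr. ring. Qed.

Lemma lucas_succ_V (P Q : Z) (n : nat) :
  2 * lucasV P Q (S n) = P * lucasV P Q n + discr P Q * lucasU P Q n.
Proof. rewrite !lucasV_lucasU, lucasU_SS. unfold discr. ring. Qed.

Lemma lucas_succ_U (P Q : Z) (n : nat) :
  2 * lucasU P Q (S n) = lucasV P Q n + P * lucasU P Q n.
Proof. rewrite !lucasV_lucasU. ring. Qed.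

Lemma lucasU_add (P Q : Z) (m n : nat) :
  lucasU P Q (S (m + n))
  = lucasU P Q (S m) * lucasU P Q (S n) - Q * lucasU P Q m * lucasU P Q n.
Proof.
  induction m as [| | m IH1 IH2] using two_step_ind.
  - simpl (0 + n)%nat. change (lucasU P Q 1) with 1. change (lucasU P Q 0) with 0. ring.
  - change (1 + n)%nat with (S n). rewrite lucasU_SS, (lucasU_SS _ _ 0).
    change (lucasU P Q 1) with 1. change (lucasU P Q 0) with 0. ring.
  - simpl (S (S m) + n)%nat. rewrite lucasU_SS.
    simpl (S m + n)%nat in IH2. rewrite IH2, IH1, !(lucasU_SS _ _ (S m)), (lucasU_SS _ _ m).
    ring.
Qed.

Lemma lucasU_double (P Q : Z) (n : nat) :
  lucasU P Q (n + n) = lucasU P Q n * lucasV P Q n.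
Proof.
  destruct n as [| n]; [reflexivity |].
  replace (S n + S n)%nat with (S (S n + n)) by lia.
  rewrite lucasU_add, lucasV_lucasU, !lucasU_SS. ring.
Qed.

Lemma lucasV_double (P Q : Z) (n : nat) :
  lucasV P Q (n + n) = lucasV P Q n * lucasV P Q n - 2 * Q ^ Z.of_nat n.
Proof.
  rewrite (lucasV_lucasU _ _ (n + n)), lucasU_add, lucasU_double, <- (lucasU_quadratic P Q n).
  rewrite lucasV_lucasU. ring.
Qed.

(** The [i]-th powers of the two roots have sum [V_i] and product [Q^i], so a subsequence with step
    [i] obeys the Lucas recurrence with these parameters. *)
Lemma lucasV_add_double (P Q : Z) (i m : nat) :
  lucasV P Q (m + i + i)
  = lucasV P Q i * lucasV P Q (m + i) - Q ^ Z.of_nat i * lucasV P Q m.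
Proof.
  induction m as [| | m IH1 IH2] using two_step_ind.
  - simpl (0 + i)%nat. rewrite lucasV_double. change (lucasV P Q 0) with 2. ring.
  - replace (1 + i + i)%nat with (S (i + i)) by lia. change (1 + i)%nat with (S i).
    change (lucasV P Q 1) with P.
    rewrite <- (lucasU_quadratic P Q i), (lucasV_lucasU _ _ (S (i + i))), lucasU_SS.
    rewrite lucasU_add, lucasU_double, !lucasV_lucasU, lucasU_SS. ring.
  - replace (S (S m) + i + i)%nat with (S (S (m + i + i))) by lia.
    replace (S (S m) + i)%nat with (S (S (m + i))) by lia.
    rewrite !lucasV_SS. simpl (S m + i)%nat in IH2. simpl (S _ + i)%nat in IH2.
    rewrite IH1, IH2. ring.
Qed.

Lemma lucasV_mult (P Q : Z) (i s : nat) :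
  lucasV (lucasV P Q i) (Q ^ Z.of_nat i) s = lucasV P Q (s * i).
Proof.
  induction s as [| | s IH1 IH2] using two_step_ind.
  - reflexivity.
  - simpl (1 * i)%nat. rewrite Nat.add_0_r. reflexivity.
  - rewrite lucasV_SS, IH1, IH2.
    replace (S (S s) * i)%nat with (s * i + i + i)%nat by lia.
    replace (S s * i)%nat with (s * i + i)%nat by lia.
    now rewrite lucasV_add_double.
Qed.

Lemma lucasV_bounds (P Q : Z) (n : nat) :
  regular P Q -> 0 < lucasV P Q n /\ Z.of_nat n <= lucasV P Q n.
Proof.
  intros [[-> HP] | [-> HP]].
  - enough (Z.of_nat n <= lucasV P 1 n /\ lucasV P 1 n + 1 <= lucasV P 1 (S n)
            /\ 0 < lucasV P 1 n) by tauto.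
    induction n; [cbn; lia |].
    rewrite lucasV_SS, Nat2Z.inj_succ.
    assert (3 * lucasV P 1 (S n) <= P * lucasV P 1 (S n)) by (apply Z.mul_le_mono_nonneg_r; lia).
    lia.
  - enough (Z.of_nat n <= lucasV P (-1) n /\ Z.of_nat (S n) <= lucasV P (-1) (S n)
            /\ 0 < lucasV P (-1) n) by tauto.
    induction n; [cbn; lia |].
    (* The recurrence only yields [V_(n+2) >= 2 n + 1], which suffices from [n = 1] on;
       [V_2 = P^2 + 2] is checked directly. *)
    destruct n; [cbn [lucasV Z.of_nat Pos.of_succ_nat Pos.succ] in *; nia |].
    rewrite (lucasV_SS _ _ (S n)), (Nat2Z.inj_succ (S (S n))).
    assert (1 * lucasV P (-1) (S (S n)) <= P * lucasV P (-1) (S (S n)))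
      by (apply Z.mul_le_mono_nonneg_r; lia).
    lia.
Qed.

(** Modulo 4 the equation reads [x^2 = (P y)^2], so [x] and [P y] have the same parity. This keeps
    the descent below within the integers. *)
Lemma pell_parity (P Q e x y : Z) :
  x * x - discr P Q * (y * y) = 4 * e -> exists t, x = P * y + 2 * t.
Proof.
  unfold discr; intros H.
  destruct (Z.Even_or_Odd (x - P * y)) as [[t Ht] | [t Ht]]; [exists t; lia |].
  exfalso. assert (E : x = P * y + (2 * t + 1)) by lia. subst x.
  assert (4 * (P * y * t) + 2 * (P * y) + 4 * (t * t) + 4 * t + 1 = 4 * e - 4 * Q * (y * y))
    by (rewrite <- H; ring). lia.
Qed.

(* Descent: dividing [(x + y sqrt D) / 2] by the unit [(P + sqrt D) / 2] decreases [x + 2 y]. *)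
Lemma pell_solution_lucas (P Q e x y : Z) :
  regular P Q -> e * e = 1 -> (e = 1 \/ Q = -1) -> 0 < x -> 0 <= y ->
  x * x - discr P Q * (y * y) = 4 * e ->
  exists n, lucasV P Q n = x /\ Q ^ Z.of_nat n = e.
Proof.
  intros Hr He HeQ Hx Hy H.
  enough (exists n, lucasV P Q n = x /\ lucasU P Q n = y /\ Q ^ Z.of_nat n = e)
    as (n & ? & ? & ?) by eauto.
  revert e x y Hx Hy He HeQ H.
  enough (G : forall m e x y, 0 < x -> 0 <= y -> e * e = 1 -> (e = 1 \/ Q = -1) ->
    x * x - discr P Q * (y * y) = 4 * e -> x + 2 * y <= Z.of_nat m ->
    exists n, lucasV P Q n = x /\ lucasU P Q n = y /\ Q ^ Z.of_nat n = e).
  { intros e x y Hx Hy He HeQ H. apply (G (Z.to_nat (x + 2 * y)) e x y); auto. lia. }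
  induction m as [| m IH]; intros e x y Hx Hy He HeQ H Hm; [lia |].
  destruct (Z.eq_dec y 0) as [-> | Hy0].
  { exists 0%nat. simpl. assert (e = 1 \/ e = -1) as [-> | ->] by nia; nia. }
  destruct (pell_parity _ _ _ _ _ H) as [t Ht].
  assert (He' : e = 1 \/ e = -1) by nia.
  unfold discr in H. subst x.
  (* The inverse of the unit is [Q] times its conjugate, so the quotient has coordinates [x'] and
     [- Q t], and its norm sign is [Q e]. *)
  set (x' := Q * (2 * Q * y + P * t)).
  assert (Hx'y' : 0 < x' /\ 0 <= - Q * t /\ x' + 2 * (- Q * t) < P * y + 2 * t + 2 * y).
  (* In terms of [t] the Pell equation becomes this quadratic form; each bound below follows by
     contradiction from the sign of a product of linear factors. *)
  { assert (H' : t * t + P * y * t + Q * (y * y) = e) by lia. unfold x'.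
    destruct Hr as [[-> HP] | [-> HP]].
    - destruct HeQ as [-> | ?]; [| lia].
      assert (H1 : t <= 0).
      { apply Z.nlt_ge; intros ?. assert (0 < t * (t + P * y)) by (apply Z.mul_pos_pos; nia). nia. }
      assert (H2 : - t < y).
      { apply Z.nle_gt; intros ?.
        assert (0 <= (- t - y) * (P * y + t - y)) by (apply Z.mul_nonneg_nonneg; lia). nia. }
      assert (H3 : 0 < 2 * y + P * t).
      { apply Z.nle_gt; intros ?.
        assert (0 <= (y + t) * (- (P * t) - y + t)) by (apply Z.mul_nonneg_nonneg; lia).
        assert (0 <= (y + t) * - t) by (apply Z.mul_nonneg_nonneg; lia). nia. }
      assert (0 <= (P - 2) * (y - t)) by (apply Z.mul_nonneg_nonneg; lia).
      repeat split; lia.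
    - assert (H1 : 0 <= t).
      { apply Z.nlt_ge; intros ?.
        assert (0 < - t * (P * y + t)) by (apply Z.mul_pos_pos; lia). nia. }
      assert (H2 : 0 < 2 * y - P * t).
      { apply Z.nle_gt; intros ?.
        assert (0 <= y * (P * t - 2 * y)) by (apply Z.mul_nonneg_nonneg; lia).
        assert (t = 0) by nia. subst t. lia. }
      assert (0 < P * y) by nia. assert (0 <= P * t) by nia.
      repeat split; lia. }
  destruct (IH (Q * e) x' (- Q * t)) as (n & HV & HU & Hn); try tauto; try lia.
  - pose proof (regular_sq _ _ Hr). nia.
  - destruct Hr as [[-> ?] | [-> ?]]; lia.
  - unfold x', discr. pose proof (regular_sq _ _ Hr) as HQ.
    replace (4 * (Q * e)) with (4 * e * Q) by ring. rewrite <- H.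
    destruct Hr as [[-> ?] | [-> ?]]; ring.
  - pose proof (lucas_succ_V P Q n) as EV. pose proof (lucas_succ_U P Q n) as EU.
    rewrite HV, HU in *. unfold x', discr in *.
    exists (S n). rewrite pow_S, Hn.
    destruct Hr as [[-> ?] | [-> ?]]; repeat split; try lia.
Qed.

(** * Divisibility of [lucasU] and the set of indices it defines *)

Lemma pigeonhole_seq {A : Type} (f : nat -> A) (l : list A) :
  (forall n, In (f n) l) -> exists i d, f i = f (i + S d)%nat.
Proof.
  intros Hl. apply NNPP; intros Hn.
  assert (Hinj : Injective f).
  { intros i j E. destruct (Nat.lt_trichotomy i j) as [H | [H | H]]; auto; exfalso; apply Hn.
    - exists i, (j - i - 1)%nat. rewrite E. f_equal; lia.
    - exists j, (i - j - 1)%nat. rewrite <- E. f_equal; lia. }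
  pose proof (Injective_map_NoDup Hinj (seq_NoDup (S (length l)) 0)) as Hnd.
  apply NoDup_incl_length with (l' := l) in Hnd.
  - rewrite length_map, length_seq in Hnd. lia.
  - intros x Hx. apply in_map_iff in Hx as (n & <- & _). apply Hl.
Qed.

(** Some pair of consecutive terms repeats modulo [M]. As [Q] is invertible, the recurrence runs
    backwards and carries the repetition down to [U_0 = 0]. *)
Lemma lucasU_divisible (P Q M : Z) :
  Q * Q = 1 -> 0 < M -> exists d, (M | lucasU P Q (S d)).
Proof.
  intros HQ HM.
  set (f := fun n => (lucasU P Q n mod M, lucasU P Q (S n) mod M)).
  set (l := map Z.of_nat (seq 0 (Z.to_nat M))).
  destruct (pigeonhole_seq f (list_prod l l)) as (i & d & E).
  { intros n. unfold f. apply in_prod; unfold l; apply in_map_iff;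
    (eexists (Z.to_nat (_ mod M)); split;
      [apply Z2Nat.id, Z.mod_pos_bound; lia | apply in_seq]);
    match goal with |- context [Z.to_nat (?a mod M)] =>
      pose proof (Z.mod_pos_bound a M HM) end; lia. }
  exists d.
  assert (G : (M | lucasU P Q (i + S d) - lucasU P Q i)
              /\ (M | lucasU P Q (S (i + S d)) - lucasU P Q (S i))).
  { pose proof (f_equal fst E) as E1. pose proof (f_equal snd E) as E2.
    unfold f, fst, snd in E1, E2.
    split; apply Z.mod_divide; try lia;
      rewrite Zminus_mod; [rewrite <- E1 | rewrite <- E2]; rewrite Z.sub_diag; reflexivity. }
  clear E f l. induction i as [| i IH].
  - destruct G as [G _]. change (lucasU P Q 0) with 0 in G. rewrite Z.sub_0_r in G. exact G.
  - apply IH. destruct G as [[a Ha] [b Hb]]. split; [| exists a; exact Ha].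
    change (S i + S d)%nat with (S (i + S d)) in *.
    rewrite !lucasU_SS in Hb. exists (Q * (P * a - b)).
    transitivity ((Q * Q) * (lucasU P Q (i + S d) - lucasU P Q i)); [rewrite HQ; ring |].
    transitivity (Q * (P * (a * M) - b * M)); [rewrite <- Ha, <- Hb |]; ring.
Qed.

Lemma sq_pow (Q : Z) (n : nat) : Q * Q = 1 -> Q ^ Z.of_nat n * Q ^ Z.of_nat n = 1.
Proof. intros HQ. rewrite <- Z.pow_mul_l, HQ. apply Z.pow_1_l; lia. Qed.

Lemma divide_lucasU_mult (P Q M k : Z) (i s : nat) :
  (M | k * lucasU P Q i) -> (M | k * lucasU P Q (s * i)).
Proof.
  intros H. induction s as [| s IH].
  - simpl. rewrite Z.mul_0_r. apply Z.divide_0_r.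
  - destruct i as [| i]; [now rewrite Nat.mul_0_r |].
    replace (S s * S i)%nat with (S (s * S i + i)) by lia.
    rewrite lucasU_add.
    replace (k * _) with (lucasU P Q (S (s * S i)) * (k * lucasU P Q (S i))
                          - Q * lucasU P Q i * (k * lucasU P Q (s * S i))) by ring.
    apply Z.divide_sub_r; apply Z.divide_mul_r; assumption.
Qed.

(** The addition formula leaves [k U_(i+1) U_d] divisible by [M]. The factor [U_(i+1)] cancels,
    because by [lucasU_quadratic] its square differs from the unit [Q^i] by a multiple of [U_i]. *)
Lemma divide_lucasU_sub (P Q M k : Z) (i d : nat) :
  Q * Q = 1 -> (M | k * lucasU P Q i) -> (M | k * lucasU P Q (i + d)) ->
  (M | k * lucasU P Q d).
Proof.
  intros HQ Hi Hid. destruct d as [| d].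
  { simpl. rewrite Z.mul_0_r. apply Z.divide_0_r. }
  rewrite <- plus_n_Sm, lucasU_add in Hid.
  pose proof (lucasU_quadratic P Q i) as Hq. pose proof (sq_pow Q i HQ) as He.
  set (e := Q ^ Z.of_nat i) in *. destruct Hi as [a Ha], Hid as [b Hb].
  set (u := lucasU P Q i) in *. set (v := lucasU P Q (S i)) in *.
  set (w := lucasU P Q (S d)) in *. set (w' := lucasU P Q d) in *.
  exists (e * (v * b + (v * Q * w' - P * v * w + Q * u * w) * a)).
  transitivity ((e * e) * (k * w)); [rewrite He; ring |].
  rewrite <- Hq at 2.
  transitivity (e * (v * (b * M) + (v * Q * w' - P * v * w + Q * u * w) * (a * M))); [| ring].
  rewrite <- Ha, <- Hb. ring.
Qed.

Lemma least_positive (G : nat -> Prop) (n : nat) :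
  G (S n) -> exists i, (0 < i)%nat /\ G i /\ forall m, (0 < m)%nat -> G m -> (i <= m)%nat.
Proof.
  intros H.
  destruct (dec_inh_nat_subset_has_unique_least_element (fun i => (0 < i)%nat /\ G i))
    as (i & [[Hi HG] Hmin] & _).
  - intros m. apply classic.
  - exists (S n). split; [lia | assumption].
  - exists i. repeat split; auto.
Qed.

(** Repeated subtraction of the least positive element stays in [G] and, by minimality, can only end
    at 0. *)
Lemma multiples_of_least (G : nat -> Prop) (n0 : nat) :
  G (S n0) -> (forall i d, G i -> G (i + d)%nat -> G d) ->
  exists i, (0 < i)%nat /\ G i /\ forall n, G n -> exists s, n = (s * i)%nat.
Proof.
  intros H0 Hsub. destruct (least_positive G n0 H0) as (i & Hi & HG & Hmin).
  exists i. repeat split; auto.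
  induction n as [n IH] using lt_wf_ind; intros Hn.
  destruct n as [| n]; [now exists 0%nat |].
  assert (i <= S n)%nat by (apply Hmin; [lia | assumption]).
  destruct (IH (S n - i)%nat) as [s Hs]; [lia | |].
  - apply (Hsub i); [assumption |]. now replace (i + (S n - i))%nat with (S n) by lia.
  - exists (S s). lia.
Qed.

(** * The intersection when the product of the discriminants is a square *)

Lemma pow_unit_cases (Q : Z) (n : nat) :
  Q * Q = 1 -> Q ^ Z.of_nat n = 1 \/ Q ^ Z.of_nat n = -1.
Proof. intros HQ. pose proof (sq_pow Q n HQ). nia. Qed.

(** For [x >= 5] the number [x^4 - 16] lies strictly between the squares of [x^2 - 1] and [x^2]; the
    smaller values are checked one by one. *)
Lemma fourth_power_minus_16_square (x k : Z) :
  0 < x -> x * x * (x * x) - 16 = k * k -> x = 2.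
Proof.
  intros Hx H. destruct (Z_lt_le_dec x 5).
  - assert (x = 1 \/ x = 2 \/ x = 3 \/ x = 4) as [-> | [-> | [-> | ->]]] by lia;
      [nia | reflexivity | |].
    + assert (Z.abs k <= 8 \/ 9 <= Z.abs k) as [?|?] by lia; nia.
    + assert (Z.abs k <= 15 \/ 16 <= Z.abs k) as [?|?] by lia; nia.
  - assert (25 <= x * x) by nia.
    assert (Z.abs k < x * x) by nia. nia.
Qed.

(** Multiplying the two Pell equations gives [x^4 - 16 = (k y z)^2]. *)
Lemma mixed_sign_square (D1 D2 k x y z : Z) :
  D1 * D2 = k * k -> 0 < x ->
  x * x - D1 * (y * y) = 4 -> x * x - D2 * (z * z) = -4 -> x = 2.
Proof.
  intros Hk Hx H1 H2. apply (fourth_power_minus_16_square x (k * y * z) Hx).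
  transitivity ((D1 * D2) * (y * y) * (z * z)); [| rewrite Hk; ring].
  transitivity ((x * x - 4) * (x * x + 4)); [ring |].
  replace (x * x - 4) with (D1 * (y * y)) by lia.
  replace (x * x + 4) with (D2 * (z * z)) by lia. ring.
Qed.

Lemma inV_intersection_of_square (P1 Q1 P2 Q2 : Z) :
  regular P1 Q1 -> regular P2 Q2 -> is_square (discr P1 Q1 * discr P2 Q2) ->
  exists i, (0 < i)%nat /\ forall x,
    (inV P1 Q1 x /\ inV P2 Q2 x) <-> inV (lucasV P1 Q1 i) (Q1 ^ Z.of_nat i) x.
Proof.
  intros R1 R2 [k Hk].
  pose proof (regular_sq _ _ R1) as S1. pose proof (regular_sq _ _ R2) as S2.
  pose proof (regular_discr _ _ R1) as d1. pose proof (regular_discr _ _ R2) as d2.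
  set (D1 := discr P1 Q1) in *. set (D2 := discr P2 Q2) in *.
  (* [G n] makes [V_n] solve the Pell equation of the second pair: if [k U_n = w D2], then
     [D2 w^2 = D1 U_n^2]. The first condition is there because for [Q2 = 1] only the sign 1 is
     attained. *)
  set (G := fun n => (Q1 ^ Z.of_nat n = 1 \/ Q2 = -1) /\ (D2 | k * lucasU P1 Q1 n)).
  destruct (lucasU_divisible P1 Q1 D2 S1 d2) as [d Hd].
  (* The positive index [2 (d + 1)] lies in [G]: doubling turns the sign into 1, and
     [U_(2n) = U_n V_n] preserves the divisibility. *)
  destruct (multiples_of_least G (d + S d)) as (i & Hi & [Gi1 Gi2] & Hmul).
  - unfold G. replace (S (d + S d)) with (S d + S d)%nat by lia. split.
    + left. rewrite Nat2Z.inj_add, Z.pow_add_r by lia. now apply sq_pow.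
    + rewrite lucasU_double. now apply Z.divide_mul_r, Z.divide_mul_l.
  - unfold G. intros m n [Hm1 Hm2] [Hn1 Hn2]. split.
    + destruct Hm1 as [Hm1 |]; [| tauto]. destruct Hn1 as [Hn1 |]; [| tauto].
      left. rewrite Nat2Z.inj_add, Z.pow_add_r, Hm1 in Hn1 by lia. lia.
    + now apply (divide_lucasU_sub P1 Q1 D2 k m n).
  - exists i. split; [assumption |]. intros x; split.
    + intros [[n Hn] [m Hm]].
      pose proof (lucas_pell P1 Q1 n) as E1. pose proof (lucas_pell P2 Q2 m) as E2.
      rewrite Hn in E1. rewrite Hm in E2. fold D1 in E1. fold D2 in E2.
      assert (Hx : 0 < x) by (rewrite <- Hn; now apply lucasV_bounds).
      assert (H2 : x = 2 -> inV (lucasV P1 Q1 i) (Q1 ^ Z.of_nat i) x)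
        by (intros ->; now exists 0%nat).
      assert (HG : Q1 ^ Z.of_nat n = Q2 ^ Z.of_nat m ->
                   inV (lucasV P1 Q1 i) (Q1 ^ Z.of_nat i) x).
      { intros E. rewrite <- E in E2.
        destruct (Hmul n) as [s ->]; [| exists s; now rewrite lucasV_mult].
        split.
        - destruct R2 as [[-> _] | [-> _]]; [| now right].
          rewrite Z.pow_1_l in E by lia. now left.
        - set (u := lucasU P1 Q1 n) in *. set (w := lucasU P2 Q2 m) in *.
          assert (E' : (D2 * w) * (D2 * w) = (k * u) * (k * u)).
          { transitivity (k * k * (u * u)); [rewrite <- Hk | ring].
            transitivity (D2 * (D2 * (w * w))); [ring |].
            replace (D2 * (w * w)) with (D1 * (u * u)) by lia. ring. }
          assert (k * u = w * D2 \/ k * u = - w * D2) as [F | F] by nia;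
            [now exists w | now exists (- w)]. }
      (* Equal signs put [n] into [G]; opposite signs force [x = 2], the value at index 0. *)
      destruct (pow_unit_cases Q1 n S1) as [F1 | F1], (pow_unit_cases Q2 m S2) as [F2 | F2];
        rewrite F1 in *; rewrite F2 in *; auto; apply H2.
      * eapply mixed_sign_square; eauto.
      * eapply (mixed_sign_square D2 D1); [rewrite <- Hk; ring | eauto ..].
    + intros [s Hs]. rewrite lucasV_mult in Hs. subst x. split; [now eexists |].
      pose proof (lucas_pell P1 Q1 (s * i)) as E1. fold D1 in E1.
      set (e := Q1 ^ Z.of_nat (s * i)) in *. set (x := lucasV P1 Q1 (s * i)) in *.
      destruct (divide_lucasU_mult P1 Q1 D2 k i s Gi2) as [w Hw].
      destruct (pell_solution_lucas P2 Q2 e x (Z.abs w)) as (n & Hn & _); auto.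
      * now apply sq_pow.
      * destruct Gi1 as [Gi1 |]; [left | now right]. unfold e.
        rewrite Nat2Z.inj_mul, Z.mul_comm, Z.pow_mul_r, Gi1 by lia. apply Z.pow_1_l; lia.
      * now apply lucasV_bounds.
      * lia.
      * fold D2. rewrite <- E1. set (u := lucasU P1 Q1 (s * i)) in *.
        replace (Z.abs w * Z.abs w) with (w * w) by (symmetry; apply Z.abs_square).
        enough (D2 * (w * w) = D1 * (u * u)) by lia.
        apply (Z.mul_reg_l _ _ D2); [lia |].
        transitivity ((w * D2) * (w * D2)); [ring |]. rewrite <- Hw.
        transitivity ((k * k) * (u * u)); [ring | rewrite <- Hk; ring].
      * now exists n.
Qed.

Lemma infinite_lucasV_subseq (P Q : Z) (i : nat) :
  regular P Q -> (0 < i)%nat -> infinite_Zset (inV (lucasV P Q i) (Q ^ Z.of_nat i)).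
Proof.
  intros R Hi [l Hl].
  set (m := fold_right Z.max 0 l).
  assert (Hm : forall x, In x l -> x <= m).
  { unfold m. clear. induction l as [| a l IH]; simpl; [tauto |].
    intros x [-> | H]; [lia |]. specialize (IH x H). lia. }
  assert (H0 : 0 <= m) by (unfold m; clear; induction l; simpl; lia).
  set (s := Z.to_nat (m + 1)).
  specialize (Hl (lucasV P Q (s * i))). specialize (Hm (lucasV P Q (s * i))).
  destruct (lucasV_bounds P Q (s * i) R) as [_ Hb].
  assert (Z.of_nat s <= Z.of_nat (s * i)) by nia.
  enough (lucasV P Q (s * i) <= m) by lia.
  apply Hm, Hl. exists s. apply lucasV_mult.
Qed.

Open Scope R_scope.

(** * Binomial series with half-integer exponent *)

(** The generalized binomial coefficient [nu] over [i] for real [nu]. *)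
Fixpoint bin (nu : R) (i : nat) : R :=
  match i with
  | O => 1
  | S j => bin nu j * (nu - INR j) / INR (S j)
  end.

Lemma bin_S (nu : R) (i : nat) : bin nu (S i) = bin nu i * (nu - INR i) / INR (S i).
Proof. reflexivity. Qed.

Lemma bin_pascal (nu : R) (i : nat) : bin (nu + 1) (S i) = bin nu (S i) + bin nu i.
Proof.
  induction i as [| i IH]; [simpl; field |].
  rewrite bin_S, IH, (bin_S nu (S i)), !(bin_S nu i), !S_INR.
  pose proof (pos_INR i). field. lra.
Qed.

Lemma bin_absorb (nu : R) (i : nat) : bin nu i * (nu - INR i) = nu * bin (nu - 1) i.
Proof.
  induction i as [| i IH]; [simpl; ring |].
  rewrite !bin_S. transitivity (bin nu i * (nu - INR i) * ((nu - INR (S i)) / INR (S i))).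
  { field. apply not_0_INR. lia. }
  rewrite IH, !S_INR. pose proof (pos_INR i). field. lra.
Qed.

Lemma is_lim_seq_bounded_geom (a : nat -> R) (M r : R) :
  (forall n, Rabs (a n) <= M) -> Rabs r < 1 -> is_lim_seq (fun n => a n * r ^ n) 0.
Proof.
  intros Ha Hr. apply is_lim_seq_abs_0.
  apply (is_lim_seq_le_le (fun _ => 0) _ (fun n => M * Rabs r ^ n)).
  - intros n. rewrite Rabs_mult, RPow_abs. split.
    + apply Rmult_le_pos; apply Rabs_pos.
    + apply Rmult_le_compat_r; [apply Rabs_pos | apply Ha].
  - apply is_lim_seq_const.
  - replace (Finite 0) with (Rbar_mult M 0) by (simpl; f_equal; ring).
    apply is_lim_seq_scal_l, is_lim_seq_geom. now rewrite Rabs_Rabsolu.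
Qed.

(** Outside the disk of convergence the terms do not tend to 0, whereas bounded coefficients make
    them tend to 0 at the midpoint [r] of [|x|] and 1. *)
Lemma CV_radius_bounded_coef (a : nat -> R) (M x : R) :
  (forall n, Rabs (a n) <= M) -> Rabs x < 1 -> Rbar_lt (Rabs x) (CV_radius a).
Proof.
  intros Ha Hx. apply Rbar_not_le_lt; intros H.
  set (r := (Rabs x + 1) / 2). pose proof (Rabs_pos x).
  assert (Hr : Rabs r = r) by (apply Rabs_pos_eq; unfold r; lra).
  apply (CV_disk_outside a r).
  - rewrite Hr. eapply Rbar_le_lt_trans; [exact H |]. simpl. unfold r; lra.
  - apply (is_lim_seq_bounded_geom a M r Ha). rewrite Hr. unfold r; lra.
Qed.

Lemma bin_neg_half_bound (i : nat) : Rabs (bin (- (1/2)) i) <= 1.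
Proof.
  induction i as [| i IH]; [simpl; rewrite Rabs_R1; lra |].
  rewrite bin_S, S_INR. pose proof (pos_INR i).
  replace (bin (- (1/2)) i * (- (1/2) - INR i) / (INR i + 1))
    with (bin (- (1/2)) i * - ((1/2 + INR i) / (INR i + 1))) by (field; lra).
  rewrite Rabs_mult. apply Rle_trans with (1 * 1); [| lra].
  apply Rmult_le_compat; try apply Rabs_pos; [assumption |].
  rewrite Rabs_Ropp, Rabs_pos_eq by (apply Rdiv_le_0_compat; lra).
  apply Rle_div_l; lra.
Qed.

(** The sum [g] satisfies [(1 + t) g' = - g / 2], so [g(t) sqrt (1 + t)] has derivative 0 and keeps
    its value 1 at 0. The other exponents [m + 1/2] are reached from this one by multiplication by
    [1 + x]. *)
Lemma bin_neg_half_series (x : R) :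
  Rabs x < 1 -> is_series (fun n => bin (- (1/2)) n * x ^ n) (/ sqrt (1 + x)).
Proof.
  intros Hx. set (a := bin (- (1/2))).
  assert (HR : forall t, Rabs t < 1 -> Rbar_lt (Rabs t) (CV_radius a)).
  { intros t Ht. apply (CV_radius_bounded_coef a 1); [apply bin_neg_half_bound | assumption]. }
  assert (HE : forall t, Rabs t < 1 ->
            (1 + t) * PSeries (PS_derive a) t = - (1/2) * PSeries a t).
  { intros t Ht. pose proof (HR t Ht) as Hr.
    assert (Hd : ex_pseries (PS_derive a) t) by now apply ex_pseries_derive.
    transitivity (PSeries (PS_plus (PS_derive a) (PS_incr_1 (PS_derive a))) t).
    - rewrite PSeries_plus, PSeries_incr_1; [ring | assumption | now apply ex_pseries_incr_1].
    - rewrite <- PSeries_scal. apply PSeries_ext. intros n.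
      unfold PS_plus, PS_derive, PS_scal, PS_incr_1, plus, scal; simpl. unfold mult; simpl.
      change (a n) with (bin (-(1/2)) n).
      pose proof (pos_INR n).
      destruct n as [| n].
      + change (a 1%nat) with (1 * (- (1 / 2) - INR 0) / INR 1). simpl. unfold zero; simpl. field.
      + change (match S n with 0%nat => 1 | S _ => INR (S n) + 1 end) with (INR (S (S n))).
        change (a (S (S n))) with (bin (-(1/2)) (S n) * (- (1/2) - INR (S n)) / INR (S (S n))).
        change (a (S n)) with (bin (-(1/2)) (S n)).
        change (match n with 0%nat => 1 | S _ => INR n + 1 end) with (INR (S n)).
        rewrite (S_INR (S n)). field. lra. }
  assert (HC : PSeries a x * sqrt (1 + x) = 1).
  { set (f := fun t => PSeries a t * sqrt (1 + t)).
    assert (H0 : f 0 = 1).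
    { unfold f. rewrite Rplus_0_r, sqrt_1, PSeries_0. unfold a; simpl; ring. }
    assert (Hder : forall t, Rabs t < 1 -> is_derive f t 0).
    { intros t Ht. pose proof (Rabs_def2 _ _ Ht).
      assert (Hs : 0 < sqrt (1 + t)) by (apply sqrt_lt_R0; lra).
      unfold f. evar_last.
      - apply (is_derive_mult (PSeries a) (fun t => sqrt (1 + t))).
        + apply is_derive_PSeries. auto.
        + apply (is_derive_sqrt (fun t => 1 + t) t 1); [auto_derive; auto; ring | lra].
        + intros; apply Rmult_comm.
      - unfold plus, mult, scal; simpl. unfold mult; simpl.
        apply (Rmult_eq_reg_r (sqrt (1 + t))); [| lra].
        transitivity (PSeries (PS_derive a) t * (sqrt (1 + t) * sqrt (1 + t))
                      + PSeries a t / 2); [field; lra |].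
        rewrite sqrt_sqrt by lra.
        rewrite (Rmult_comm _ (1 + t)), HE by assumption. field. }
    change (f x = 1). rewrite <- H0. pose proof (Rabs_def2 _ _ Hx) as [? ?].
    destruct (Rtotal_order x 0) as [Hn | [-> | Hp]]; [| reflexivity |].
    - apply eq_is_derive; [| assumption]. intros t Ht. apply Hder, Rabs_def1; lra.
    - symmetry. apply eq_is_derive; [| assumption]. intros t Ht. apply Hder, Rabs_def1; lra. }
  replace (/ sqrt (1 + x)) with (PSeries a x).
  - apply (proj1 (is_pseries_R a x _)), PSeries_correct, CV_radius_inside, HR, Hx.
  - pose proof (Rabs_def2 _ _ Hx) as [? ?].
    assert (Hs : 0 < sqrt (1 + x)) by (apply sqrt_lt_R0; lra).
    apply (Rmult_eq_reg_r (sqrt (1 + x))); [| lra]. rewrite HC. field. lra.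
Qed.

Lemma is_series_plus_R (a b : nat -> R) (l m : R) :
  is_series a l -> is_series b m -> is_series (fun n => a n + b n) (l + m).
Proof. intros H1 H2. exact (is_series_plus a b l m H1 H2). Qed.

Lemma is_series_scal_R (c : R) (a : nat -> R) (l : R) :
  is_series a l -> is_series (fun n => c * a n) (c * l).
Proof. intros H. exact (is_series_scal_l c a l H). Qed.

Lemma is_series_pad (a : nat -> R) (n : nat) (l : R) :
  (forall h, (h < n)%nat -> a h = 0) -> is_series (fun d => a (n + d)%nat) l -> is_series a l.
Proof.
  revert a. induction n as [| n IH]; intros a H0 Ha; [exact Ha |].
  apply is_series_decr_1. rewrite (H0 0%nat) by lia.
  unfold plus, opp; simpl. rewrite Ropp_0, Rplus_0_r.
  apply IH; [| exact Ha]. intros h Hh. apply H0. lia.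
Qed.

Lemma bin_series_step (nu x l : R) :
  is_series (fun n => bin nu n * x ^ n) l ->
  is_series (fun n => bin (nu + 1) n * x ^ n) ((1 + x) * l).
Proof.
  intros H. replace ((1 + x) * l) with (l + x * l) by ring.
  apply is_series_ext with (fun n => bin nu n * x ^ n
    + match n with O => 0 | S m => x * (bin nu m * x ^ m) end).
  - intros [| n]; [simpl; ring |]. rewrite bin_pascal. simpl; ring.
  - apply is_series_plus_R; [assumption |].
    apply (is_series_pad _ 1); [intros h Hh; now replace h with 0%nat by lia |].
    simpl. apply is_series_scal_R, H.
Qed.

Lemma bin_series (m : nat) (x : R) :
  Rabs x < 1 -> is_series (fun n => bin (INR m + 1/2) n * x ^ n) ((1 + x) ^ m * sqrt (1 + x)).
Proof.
  intros Hx. pose proof (Rabs_def2 _ _ Hx) as [? ?].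
  assert (Hs : 0 < sqrt (1 + x)) by (apply sqrt_lt_R0; lra).
  induction m as [| m IH].
  - replace (INR 0 + 1/2) with (- (1/2) + 1) by (simpl; field).
    replace ((1 + x) ^ 0 * sqrt (1 + x)) with ((1 + x) * / sqrt (1 + x)).
    + apply bin_series_step, bin_neg_half_series, Hx.
    + rewrite <- (sqrt_sqrt (1 + x)) at 1 by lra. simpl. field. lra.
  - rewrite S_INR. replace (INR m + 1 + 1/2) with (INR m + 1/2 + 1) by ring.
    simpl pow. rewrite Rmult_assoc. now apply bin_series_step.
Qed.

(** * Size, integrality and signs of the coefficients *)

Lemma bin_step_bound (nu M : R) :
  0 <= M -> (forall i, Rabs (bin nu i) <= M) -> 1 <= M ->
  forall i, Rabs (bin (nu + 1) i) <= 2 * M.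
Proof.
  intros HM H H1 [| i]; [simpl; rewrite Rabs_R1; lra |].
  rewrite bin_pascal. eapply Rle_trans; [apply Rabs_triang |].
  pose proof (H i). pose proof (H (S i)). lra.
Qed.

Lemma bin_half_bound (m i : nat) : Rabs (bin (INR m + 1/2) i) <= 2 ^ S m.
Proof.
  revert i. induction m as [| m IH].
  - replace (INR 0 + 1/2) with (- (1/2) + 1) by (simpl; field).
    apply bin_step_bound; [lra | apply bin_neg_half_bound | lra].
  - rewrite S_INR. replace (INR m + 1 + 1/2) with (INR m + 1/2 + 1) by ring.
    change (2 ^ S (S m)) with (2 * 2 ^ S m).
    assert (1 <= 2 ^ S m) by (apply pow_R1_Rle; lra).
    apply bin_step_bound; [lra | exact IH | lra].
Qed.

Lemma C_integer (n i : nat) : (i <= n)%nat -> exists z : Z, Binomial.C n i = IZR z.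
Proof.
  revert i. induction n as [| n IH]; intros i Hi.
  - replace i with 0%nat by lia. exists 1%Z. unfold Binomial.C; simpl. field.
  - destruct i as [| i].
    + exists 1%Z. unfold Binomial.C. rewrite Nat.sub_0_r. simpl (fact 0).
      change (INR 1) with 1. field. apply INR_fact_neq_0.
    + destruct (Nat.eq_dec i n) as [-> | Hn].
      * exists 1%Z. unfold Binomial.C. rewrite Nat.sub_diag. simpl (fact 0).
        change (INR 1) with 1. field. apply INR_fact_neq_0.
      * rewrite <- pascal by lia.
        destruct (IH i) as [u ->]; [lia |]. destruct (IH (S i)) as [v ->]; [lia |].
        exists (u + v)%Z. now rewrite plus_IZR.
Qed.

(** Central binomial coefficients show that [4 ^ i] clears the denominators at exponent -1/2;
    Pascal's rule then transfers this to [m + 1/2]. *)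
Lemma bin_neg_half_central (i : nat) :
  4 ^ i * bin (- (1/2)) i = (-1) ^ i * Binomial.C (i + i) i.
Proof.
  induction i as [| i IH]; [unfold Binomial.C; simpl; field |].
  rewrite bin_S.
  transitivity (4 ^ i * bin (- (1/2)) i * (4 * (- (1/2) - INR i) / INR (S i))).
  { simpl pow. field. apply not_0_INR; lia. }
  rewrite IH. unfold Binomial.C.
  replace (S i + S i - S i)%nat with (S i) by lia. replace (i + i - i)%nat with i by lia.
  replace (S i + S i)%nat with (S (S (i + i))) by lia.
  rewrite !fact_simpl, !mult_INR, !S_INR, plus_INR. simpl pow.
  pose proof (pos_INR i). pose proof (INR_fact_neq_0 i). field. repeat split; auto; lra.
Qed.

Lemma bin_half_integer (m i : nat) : exists c : Z, 4 ^ i * bin (INR m + 1/2) i = IZR c.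
Proof.
  enough (G : forall i, exists c : Z, 4 ^ i * bin (INR m + 1/2) i = IZR c) by apply G.
  assert (step : forall nu, (forall i, exists c : Z, 4 ^ i * bin nu i = IZR c) ->
                 forall i, exists c : Z, 4 ^ i * bin (nu + 1) i = IZR c).
  { intros nu H [| j]; [exists 1%Z; simpl; ring |].
    destruct (H j) as [u Hu], (H (S j)) as [v Hv]. exists (v + 4 * u)%Z.
    rewrite plus_IZR, mult_IZR, <- Hu, <- Hv, bin_pascal. simpl pow. ring. }
  induction m as [| m IH].
  - replace (INR 0 + 1/2) with (- (1/2) + 1) by (simpl; field).
    apply step. intros j. rewrite bin_neg_half_central.
    destruct (C_integer (j + j) j) as [u ->]; [lia |].
    exists ((-1) ^ Z.of_nat j * u)%Z. now rewrite mult_IZR, <- pow_IZR.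
  - rewrite S_INR. replace (INR m + 1 + 1/2) with (INR m + 1/2 + 1) by ring.
    now apply step.
Qed.

Lemma bin_half_neq_0 (m i : nat) : bin (INR m + 1/2) i <> 0.
Proof.
  induction i as [| i IH]; [simpl; lra |].
  rewrite bin_S. assert (INR (S i) <> 0) by (apply not_0_INR; lia).
  enough (INR m + 1/2 - INR i <> 0).
  { unfold Rdiv. repeat apply Rmult_integral_contrapositive_currified; auto.
    now apply Rinv_neq_0_compat. }
  intros E. assert (E' : IZR (2 * Z.of_nat m + 1) = IZR (2 * Z.of_nat i)).
  { rewrite plus_IZR, !mult_IZR, <- !INR_IZR_INZ. lra. }
  apply eq_IZR in E'. lia.
Qed.

(** A nonzero integer has absolute value at least 1, and [4 ^ i] times the coefficient is such an
    integer. *)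
Lemma bin_half_lower (m i : nat) : / 4 ^ i <= Rabs (bin (INR m + 1/2) i).
Proof.
  destruct (bin_half_integer m i) as [c Hc]. pose proof (bin_half_neq_0 m i) as H0.
  assert (H4 : 0 < 4 ^ i) by (apply pow_lt; lra).
  apply (Rmult_le_reg_l (4 ^ i)); [assumption |]. rewrite Rinv_r by lra.
  rewrite <- (Rabs_pos_eq (4 ^ i)) by lra. rewrite <- Rabs_mult, Hc, <- abs_IZR.
  apply IZR_le. enough (c <> 0%Z) by lia. intros ->.
  apply Rmult_integral in Hc as [?|?]; [lra | auto].
Qed.

(** For [h > m] the factor [m + 1/2 - h] is negative, so each coefficient from index [n] on has the
    sign opposite to its predecessor's. *)
Lemma bin_half_alternate (m n e : nat) :
  (m < n)%nat -> 0 < bin (INR m + 1/2) n * bin (INR m + 1/2) (n + 2 * e).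
Proof.
  intros Hn. induction e as [| e IH].
  - rewrite Nat.mul_0_r, Nat.add_0_r. pose proof (bin_half_neq_0 m n) as H.
    pose proof (Rsqr_pos_lt _ H). unfold Rsqr in *. lra.
  - replace (n + 2 * S e)%nat with (S (S (n + 2 * e))) by lia.
    rewrite !bin_S. set (h := (n + 2 * e)%nat) in *.
    assert (H1 : INR m + 1 <= INR h) by (rewrite <- S_INR; apply le_INR; unfold h; lia).
    assert (H2 : 0 < INR (S h)) by (apply lt_0_INR; lia).
    assert (H3 : 0 < INR (S (S h))) by (apply lt_0_INR; lia).
    replace (bin (INR m + 1 / 2) n * _) with
      (bin (INR m + 1 / 2) n * bin (INR m + 1 / 2) h *
       ((INR h - (INR m + 1/2)) / INR (S h) * ((INR (S h) - (INR m + 1/2)) / INR (S (S h)))))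
      by (field; lra).
    rewrite !S_INR in *.
    apply Rmult_lt_0_compat; [assumption |].
    apply Rmult_lt_0_compat; apply Rdiv_lt_0_compat; lra.
Qed.

(** * Simultaneous Padé approximation to [sqrt (1 - z)] and [sqrt (1 + z)] *)

(* Coefficients of [f(u) / (1 - s u)]. *)
Fixpoint geo (s : R) (f : nat -> R) (d : nat) : R :=
  match d with
  | O => f 0%nat
  | S d' => s * geo s f d' + f (S d')
  end.

Lemma geo_comm (s t : R) (f : nat -> R) : geo s (geo t f) = geo t (geo s f).
Proof.
  apply functional_extensionality; intros d.
  induction d as [| | d IH1 IH2] using two_step_ind; [reflexivity | simpl; ring |].
  change (s * geo s (geo t f) (S d) + (t * geo t f (S d) + f (S (S d)))
          = t * geo t (geo s f) (S d) + (s * geo s f (S d) + f (S (S d)))).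
  replace (geo t f (S d)) with (geo s (geo t f) (S d) - s * geo s (geo t f) d) by (simpl; ring).
  replace (geo s f (S d)) with (geo t (geo s f) (S d) - t * geo t (geo s f) d) by (simpl; ring).
  rewrite IH1, IH2. ring.
Qed.

(* [hc b c d] is the complete homogeneous symmetric polynomial of degree [d] at [b] copies of [1]
   and [c] copies of [-1]: the coefficient of [u ^ d] in [1 / ((1 - u) ^ b (1 + u) ^ c)]. *)
Definition hc (b c : nat) : nat -> R :=
  Nat.iter b (geo 1) (Nat.iter c (geo (-1)) (fun d => match d with O => 1 | _ => 0 end)).

Lemma hc_S_l (b c : nat) : hc (S b) c = geo 1 (hc b c).
Proof. reflexivity. Qed.

Lemma hc_S_r (b c : nat) : hc b (S c) = geo (-1) (hc b c).
Proof.
  induction b as [| b IH]; [reflexivity |].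
  rewrite !hc_S_l, IH. apply geo_comm.
Qed.

Lemma hc_0 (b c : nat) : hc b c 0 = 1.
Proof.
  induction b as [| b IH]; [| exact IH].
  induction c as [| c IH]; [reflexivity | exact IH].
Qed.

(** Division by [1 - s u] with [|s| = 1] replaces coefficients by signed partial sums, and
    [2^n + ... + 2^(n+d) < 2^(n+1+d)]. *)
Lemma hc_bound (b c d : nat) : Rabs (hc b c d) <= 2 ^ (b + c + d).
Proof.
  assert (step : forall s f n, Rabs s = 1 -> (forall d, Rabs (f d) <= 2 ^ (n + d)) ->
            forall d, Rabs (geo s f d) <= 2 ^ (S n + d)).
  { intros s f n Hs Hf d'.
    induction d' as [| d' IH].
    - simpl geo. eapply Rle_trans; [apply Hf |]. apply Rle_pow; [lra | lia].
    - simpl geo. eapply Rle_trans; [apply Rabs_triang |]. rewrite Rabs_mult, Hs.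
      replace (S n + S d')%nat with (S (S n + d')) by lia.
      change (2 ^ S (S n + d')) with (2 * 2 ^ (S n + d')).
      pose proof (Hf (S d')) as H. replace (n + S d')%nat with (S n + d')%nat in H by lia. lra. }
  revert d. induction b as [| b IH].
  - induction c as [| c IH].
    + intros [| d]; unfold hc; simpl; [rewrite Rabs_R1; lra |].
      rewrite Rabs_R0. pose proof (pow_lt 2 d). lra.
    + intros d. rewrite hc_S_r. apply (step (-1) _ (0 + c)%nat); [| exact IH].
      rewrite Rabs_left; lra.
  - intros d. rewrite hc_S_l. apply (step 1 _ (b + c)%nat); [apply Rabs_R1 | exact IH].
Qed.

(** The generating function is [1 / (1 - u^2)^b]. This is what gives the final series terms of
    constant sign. *)
Lemma hc_diag (b e : nat) : 0 <= hc b b (2 * e) /\ hc b b (2 * e + 1) = 0.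
Proof.
  revert e. induction b as [| b IH]; intros e.
  - destruct e as [| e]; [unfold hc; simpl; lra |].
    replace (2 * S e)%nat with (S (2 * e + 1)) by lia. unfold hc; simpl. lra.
  - rewrite hc_S_l, hc_S_r.
    induction e as [| e IHe].
    + pose proof (IH 0%nat) as H. simpl in *. lra.
    + replace (2 * S e + 1)%nat with (S (S (2 * e + 1))) by lia.
      replace (2 * S e)%nat with (S (S (2 * e))) by lia.
      assert (E : forall f d, geo 1 (geo (-1) f) (S (S d)) = geo 1 (geo (-1) f) d + f (S (S d)))
        by (intros; simpl; ring).
      rewrite !E. pose proof (IH (S e)) as H.
      replace (2 * S e + 1)%nat with (S (S (2 * e + 1))) in H by lia.
      replace (2 * S e)%nat with (S (S (2 * e))) in H by lia. lra.
Qed.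

Lemma hc_alternate (c d : nat) : hc 0 c d = (-1) ^ d * hc c 0 d.
Proof.
  revert d. induction c as [| c IH].
  - intros [| d]; unfold hc; simpl; ring.
  - rewrite hc_S_r, hc_S_l. induction d as [| d IHd]; cbn [geo]; rewrite ?IHd, IH; cbn [pow]; ring.
Qed.

(** Since [hc (S i) 0 d] is the binomial coefficient [i + d] over [i], this is trinomial revision.
    It evaluates the [i]-th Taylor coefficient of [w -> (1 + w z)^nu] at [w = 1] as
    [bin nu i z^i (1 + z)^(nu - i)]. *)
Lemma bin_shift (nu : R) (i d : nat) :
  bin nu (i + d) * hc (S i) 0 d = bin nu i * bin (nu - INR i) d.
Proof.
  revert d. induction i as [| i IH].
  - intros d. replace (hc 1 0 d) with 1.
    + simpl. rewrite Rminus_0_r. ring.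
    + induction d as [| d IHd]; [reflexivity |]. unfold hc in *; simpl in *. rewrite <- IHd. ring.
  - induction d as [| d IHd].
    + rewrite hc_0, Nat.add_0_r. simpl bin at 3. ring.
    + rewrite hc_S_l. cbn [geo]. rewrite <- hc_S_l.
      replace (S i + S d)%nat with (S (S i + d)) by lia.
      assert (Hd : INR (S (S i + d)) <> 0) by (apply not_0_INR; lia).
      transitivity ((bin nu (S i + d) * hc (S (S i)) 0 d
                     + bin nu (i + S d) * hc (S i) 0 (S d))
                    * (nu - INR (S i + d)) / INR (S (S i + d))).
      { replace (i + S d)%nat with (S i + d)%nat by lia. rewrite bin_S. field. exact Hd. }
      rewrite IHd, IH.
      pose proof (bin_absorb (nu - INR i) (S d)) as Ha.
      replace (nu - INR i - 1) with (nu - INR (S i)) in Ha by (rewrite S_INR; ring).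
      rewrite (bin_S nu i) in *. rewrite (bin_S (nu - INR (S i)) d) in *.
      assert (Hi : INR (S i) <> 0) by (apply not_0_INR; lia).
      assert (Hd' : INR (S d) <> 0) by (apply not_0_INR; lia).
      assert (Hb : bin (nu - INR i) (S d) * (nu - INR (S i + d)) =
        (nu - INR i) * (bin (nu - INR (S i)) d * (nu - INR (S i) - INR d) / INR (S d))).
      { rewrite <- Ha. f_equal. rewrite plus_INR, !S_INR. ring. }
      transitivity (bin nu i *
        ((nu - INR i) / INR (S i) * bin (nu - INR (S i)) d * (nu - INR (S i + d))
         + bin (nu - INR i) (S d) * (nu - INR (S i + d))) / INR (S (S i + d))).
      { field. auto. }
      rewrite Hb, (S_INR (S i + d)), !plus_INR, !S_INR.
      pose proof (pos_INR i). pose proof (pos_INR d). field. repeat split; lra.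
Qed.

(* The divided difference of [w ^ h] at the nodes [0, 1, -1] with multiplicities [a, b, c], where
   [n = a + b + c - 1]; [a] enters only through [n]. The three recurrences below are those of divided
   differences. *)
Definition hpad (n b c h : nat) : R := if (h <? n)%nat then 0 else hc b c (h - n).

Lemma hpad_lt (n b c h : nat) : (h < n)%nat -> hpad n b c h = 0.
Proof. intros H. unfold hpad. apply Nat.ltb_lt in H. now rewrite H. Qed.

Lemma hpad_add (n b c d : nat) : hpad n b c (n + d) = hc b c d.
Proof.
  unfold hpad. replace (n + d <? n)%nat with false by (symmetry; apply Nat.ltb_ge; lia).
  f_equal. lia.
Qed.

Lemma hpad_split (A : R -> R -> R -> Prop) (n : nat) (b c b1 c1 b2 c2 : nat) :
  A 0 0 0 -> A 0 1 1 ->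
  (forall d, A (hc b c d) (hc b1 c1 (S d)) (hc b2 c2 (S d))) ->
  forall h, A (hpad (S n) b c h) (hpad n b1 c1 h) (hpad n b2 c2 h).
Proof.
  intros H0 H1 HS h. destruct (Nat.lt_trichotomy h n) as [H | [-> | H]].
  - rewrite !hpad_lt by lia. exact H0.
  - rewrite (hpad_lt (S n)) by lia. rewrite <- (Nat.add_0_r n) at 2 4. rewrite !hpad_add, !hc_0.
    exact H1.
  - replace h with (S n + (h - S n))%nat by lia. rewrite hpad_add.
    replace (S n + (h - S n))%nat with (n + S (h - S n))%nat by lia. rewrite !hpad_add. apply HS.
Qed.

Lemma hpad_rec_01 (n b c h : nat) :
  hpad (S n) (S b) c h = hpad n (S b) c h - hpad n b c h.
Proof.
  revert h. apply (hpad_split (fun x y z => x = y - z)); [ring | ring |].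
  intros d. rewrite hc_S_l. simpl. ring.
Qed.

Lemma hpad_rec_02 (n b c h : nat) :
  hpad (S n) b (S c) h = hpad n b c h - hpad n b (S c) h.
Proof.
  revert h. apply (hpad_split (fun x y z => x = y - z)); [ring | ring |].
  intros d. rewrite hc_S_r. simpl. ring.
Qed.

Lemma hpad_rec_12 (n b c h : nat) :
  hpad (S n) (S b) (S c) h = (hpad n (S b) c h - hpad n b (S c) h) / 2.
Proof.
  pose proof (hpad_rec_01 n b (S c) h) as H1. pose proof (hpad_rec_02 n (S b) c h) as H2. lra.
Qed.

(** * Integer linear forms from divided differences *)

Section PadeForms.

Variables (K : nat) (N : Z).
Hypothesis HN : (16 <= N)%Z.

Let z : R := 4 / IZR N.
Let thp : R := sqrt (1 + z).
Let thm : R := sqrt (1 - z).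
(** Bound for the integer coefficient at a single node: [4^K] for clearing denominators, [2^(K+1)]
    for the binomial coefficient and [(2 N)^K] for the power of [N + 4 s]. *)
Let M : R := 2 * (16 * IZR N) ^ K.

Lemma N_ge : 16 <= IZR N.
Proof. now apply IZR_le. Qed.

Lemma z_pos : 0 < z <= 1/4.
Proof.
  pose proof N_ge. unfold z. split; [apply Rdiv_lt_0_compat; lra |].
  apply Rle_div_l; lra.
Qed.

Definition term (H : nat -> R) (h : nat) : R := bin (INR K + 1/2) h * z ^ h * H h.

(* If [H h] is a divided difference of [w ^ h], the series is that divided difference of
   [w -> (1 + w z) ^ (K + 1/2)]. *)
Definition pade_form (t : nat) (H : nat -> R) : Prop :=
  exists A B C : Z,
    Rabs (IZR B) <= 4 ^ t * M /\ Rabs (IZR C) <= 4 ^ t * M /\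
    is_series (term H) ((IZR A + IZR B * thm + IZR C * thp) / (2 ^ t * IZR N ^ K)).

Lemma M_pos : 0 < M.
Proof.
  pose proof N_ge. unfold M. apply Rmult_lt_0_compat; [lra |]. apply pow_lt; lra.
Qed.

Lemma pade_form_ext (t : nat) (H1 H2 : nat -> R) :
  (forall h, H1 h = H2 h) -> pade_form t H1 -> pade_form t H2.
Proof.
  intros E (A & B & C & ? & ? & Hs). exists A, B, C. repeat split; auto.
  eapply is_series_ext; [| exact Hs]. intros h. unfold term. now rewrite E.
Qed.

(** One step of divided differences. Nodes differ by 1 or 2, so the weights have common denominator
    2; each step costs a factor 2 in the denominator and at most 4 in the coefficients. *)
Lemma pade_form_comb (t : nat) (u v : Z) (H1 H2 : nat -> R) :
  (Z.abs u + Z.abs v <= 4)%Z ->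
  pade_form t H1 -> pade_form t H2 -> pade_form (S t) (fun h => (IZR u * H1 h + IZR v * H2 h) / 2).
Proof.
  intros Huv (A1 & B1 & C1 & HB1 & HC1 & S1) (A2 & B2 & C2 & HB2 & HC2 & S2).
  assert (Hb : forall X Y, Rabs (IZR X) <= 4 ^ t * M -> Rabs (IZR Y) <= 4 ^ t * M ->
            Rabs (IZR (u * X + v * Y)) <= 4 ^ S t * M).
  { intros X Y HX HY. rewrite plus_IZR, !mult_IZR.
    eapply Rle_trans; [apply Rabs_triang |]. rewrite !Rabs_mult.
    apply IZR_le in Huv. rewrite plus_IZR, !abs_IZR in Huv.
    pose proof (Rabs_pos (IZR u)). pose proof (Rabs_pos (IZR v)).
    pose proof (Rabs_pos (IZR X)). pose proof (Rabs_pos (IZR Y)).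
    simpl (4 ^ S t). nra. }
  exists (u * A1 + v * A2)%Z, (u * B1 + v * B2)%Z, (u * C1 + v * C2)%Z.
  repeat split; auto.
  apply (is_series_scal_R (IZR u / 2)) in S1. apply (is_series_scal_R (IZR v / 2)) in S2.
  pose proof (is_series_plus_R _ _ _ _ S1 S2) as S3.
  match type of S3 with is_series _ ?l =>
    match goal with |- is_series _ ?l' => replace l' with l end end.
  - eapply is_series_ext; [| exact S3]. intros h. simpl. unfold term. field.
  - rewrite !plus_IZR, !mult_IZR. simpl (2 ^ S t).
    pose proof N_ge. assert (0 < IZR N ^ K) by (apply pow_lt; lra).
    assert (0 < 2 ^ t) by (apply pow_lt; lra). field. split; lra.
Qed.

Lemma pade_form_up (t n : nat) (H : nat -> R) : (t <= n)%nat -> pade_form t H -> pade_form n H.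
Proof.
  intros Hn HG. induction Hn as [| n _ IH]; [assumption |].
  apply pade_form_ext with (fun h => (IZR 2 * H h + IZR 0 * H h) / 2); [intros; field |].
  now apply pade_form_comb.
Qed.

(** This is the [i]-th Taylor coefficient of [w -> (1 + w z)^(K + 1/2)] at [s] without its factor
    [sqrt (1 + s z)]. The 4 in [z = 4 / N] cancels the denominator [4^i] of the binomial
    coefficient. *)
Lemma base_coef (i : nat) (s : Z) :
  (i <= K)%nat -> (Z.abs s <= 1)%Z ->
  exists A : Z, Rabs (IZR A) <= M /\
    bin (INR K + 1/2) i * z ^ i * (1 + IZR s * z) ^ (K - i) = IZR A / IZR N ^ K.
Proof.
  intros Hi Hs. destruct (bin_half_integer K i) as [c Hc].
  pose proof N_ge as HN'.
  exists (c * (N + 4 * s) ^ Z.of_nat (K - i))%Z. rewrite mult_IZR, <- pow_IZR, <- Hc.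
  assert (E : IZR N ^ K = IZR N ^ i * IZR N ^ (K - i)) by (rewrite <- pow_add; f_equal; lia).
  assert (0 < IZR N ^ i) by (apply pow_lt; lra).
  assert (0 < IZR N ^ (K - i)) by (apply pow_lt; lra).
  split.
  - rewrite !Rabs_mult.
    assert (H1 : Rabs ((IZR (N + 4 * s)) ^ (K - i)) <= (2 * IZR N) ^ (K - i)).
    { rewrite <- RPow_abs. apply pow_incr. split; [apply Rabs_pos |].
      rewrite <- abs_IZR, <- mult_IZR. apply IZR_le. lia. }
    rewrite (Rabs_pos_eq (4 ^ i)) by (apply pow_le; lra).
    unfold M. rewrite Rpow_mult_distr, E.
    rewrite Rpow_mult_distr in H1.
    pose proof (bin_half_bound K i) as H2.
    assert (H3 : 4 ^ i <= 4 ^ K) by (apply Rle_pow; [lra | lia]).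
    assert (H4 : 2 ^ (K - i) <= 2 ^ K) by (apply Rle_pow; [lra | lia]).
    assert (H5 : 1 <= IZR N ^ i) by (apply pow_R1_Rle; lra).
    assert (H6 : 16 ^ K = 4 ^ K * 2 ^ K * 2 ^ K)
      by (rewrite <- !Rpow_mult_distr; f_equal; ring).
    assert (0 < 4 ^ i) by (apply pow_lt; lra).
    assert (0 < 2 ^ (K - i)) by (apply pow_lt; lra).
    assert (0 < 2 ^ K) by (apply pow_lt; lra).
    transitivity ((4 ^ K * 2 ^ S K) * (2 ^ K * IZR N ^ (K - i))).
    + apply Rmult_le_compat; try apply Rabs_pos.
      * apply Rmult_le_pos; [lra | apply Rabs_pos].
      * apply Rmult_le_compat; auto; [lra | apply Rabs_pos].
      * eapply Rle_trans; [exact H1 |]. apply Rmult_le_compat_r; lra.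
    + rewrite H6. simpl (2 ^ S K).
      assert (0 < 4 ^ K) by (apply pow_lt; lra).
      replace (4 ^ K * (2 * 2 ^ K) * (2 ^ K * IZR N ^ (K - i)))
        with (2 * (4 ^ K * 2 ^ K * 2 ^ K) * (1 * IZR N ^ (K - i))) by ring.
      rewrite <- (Rmult_assoc 2 (4 ^ K * 2 ^ K * 2 ^ K)). apply Rmult_le_compat_l.
      * repeat apply Rmult_le_pos; lra.
      * apply Rmult_le_compat_r; lra.
  - replace (1 + IZR s * z) with (IZR (N + 4 * s) * / IZR N)
      by (unfold z; rewrite plus_IZR, mult_IZR; field; lra).
    unfold z. replace (4 / IZR N) with (4 * / IZR N) by reflexivity.
    rewrite !Rpow_mult_distr, !pow_inv, E. field. split; lra.
Qed.

(** With 0 as the only node, the divided difference of [w^h] is 1 for [h = i] and 0 otherwise, so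
    the series is a single rational term. *)
Lemma pade_form_base_0 (i : nat) : (i <= K)%nat -> pade_form 0 (hpad i 0 0).
Proof.
  intros Hi. destruct (base_coef i 0 Hi) as (A & HA & E); [lia |].
  exists A, 0%Z, 0%Z. pose proof M_pos.
  simpl (4 ^ 0). rewrite Rmult_1_l, Rabs_R0. repeat split; try lra.
  replace ((IZR A + 0 * thm + 0 * thp) / (2 ^ 0 * IZR N ^ K)) with (IZR A / IZR N ^ K)
    by (simpl; f_equal; ring).
  rewrite <- E, Rmult_0_l, Rplus_0_r, pow1, Rmult_1_r.
  apply (is_series_pad _ i); [intros; unfold term; rewrite hpad_lt by assumption; ring |].
  apply is_series_decr_1. eapply is_series_ext with (fun _ => 0).
  - intros d. unfold term. rewrite hpad_add. unfold hc; simpl; ring.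
  - unfold term. rewrite hpad_add, hc_0, Nat.add_0_r, Rmult_1_r.
    unfold plus, opp; simpl. rewrite Rplus_opp_r.
    pose proof (is_series_scal_R 0 _ _ (is_series_geom 0 ltac:(rewrite Rabs_R0; lra))) as H0.
    rewrite Rmult_0_l in H0. eapply is_series_ext; [| exact H0]. intros; simpl; ring.
Qed.

(** With [i + 1] copies of the one node [s], [bin_shift] turns the series into a binomial series of
    exponent [K - i + 1/2] at [s z]. *)
Lemma base_series (i : nat) (s : Z) (H : nat -> R) :
  (i <= K)%nat -> (Z.abs s <= 1)%Z ->
  (forall h, (h < i)%nat -> H h = 0) ->
  (forall d, H (i + d)%nat = IZR s ^ d * hc (S i) 0 d) ->
  exists A : Z, Rabs (IZR A) <= M /\
    is_series (term H) (IZR A * sqrt (1 + IZR s * z) / IZR N ^ K).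
Proof.
  intros Hi Hs H0 Hd. destruct (base_coef i s Hi Hs) as (A & HA & E).
  exists A. split; [assumption |].
  replace (IZR A * sqrt (1 + IZR s * z) / IZR N ^ K)
    with (IZR A / IZR N ^ K * sqrt (1 + IZR s * z)).
  2: { pose proof N_ge. field. apply pow_nonzero. lra. }
  rewrite <- E, Rmult_assoc.
  apply (is_series_pad _ i); [intros; unfold term; rewrite H0 by assumption; ring |].
  assert (Hx : Rabs (IZR s * z) < 1).
  { pose proof z_pos. rewrite Rabs_mult, (Rabs_pos_eq z), <- abs_IZR by lra.
    apply IZR_le in Hs. assert (IZR (Z.abs s) * z <= 1 * z) by (apply Rmult_le_compat_r; lra).
    lra. }
  pose proof (is_series_scal_R (bin (INR K + 1/2) i * z ^ i) _ _ (bin_series (K - i) _ Hx)) as HS.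
  eapply is_series_ext; [| exact HS]. intros d. simpl. unfold term. rewrite Hd.
  replace (INR (K - i) + 1/2) with (INR K + 1/2 - INR i) by (rewrite minus_INR by lia; ring).
  rewrite Rpow_mult_distr, pow_add.
  transitivity ((bin (INR K + 1/2) i * bin (INR K + 1/2 - INR i) d) * (z ^ i * (IZR s ^ d * z ^ d)));
    [ring |].
  rewrite <- bin_shift. ring.
Qed.

Lemma pade_form_base_1 (i : nat) : (i <= K)%nat -> pade_form 0 (hpad i (S i) 0).
Proof.
  intros Hi. destruct (base_series i 1 (hpad i (S i) 0) Hi) as (A & HA & HS).
  - lia.
  - intros; now apply hpad_lt.
  - intros d. rewrite hpad_add, pow1. ring.
  - exists 0%Z, 0%Z, A. pose proof M_pos. simpl (4 ^ 0). rewrite Rmult_1_l, Rabs_R0.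
    repeat split; try lra. unfold thp. rewrite Rmult_1_l in HS.
    replace ((0 + 0 * thm + IZR A * sqrt (1 + z)) / (2 ^ 0 * IZR N ^ K))
      with (IZR A * sqrt (1 + z) / IZR N ^ K) by (simpl; f_equal; ring).
    exact HS.
Qed.

Lemma pade_form_base_2 (i : nat) : (i <= K)%nat -> pade_form 0 (hpad i 0 (S i)).
Proof.
  intros Hi. destruct (base_series i (-1) (hpad i 0 (S i)) Hi) as (A & HA & HS).
  - lia.
  - intros; now apply hpad_lt.
  - intros d. rewrite hpad_add. apply hc_alternate.
  - exists 0%Z, A, 0%Z. pose proof M_pos. simpl (4 ^ 0). rewrite Rmult_1_l, Rabs_R0.
    repeat split; try lra. unfold thm.
    replace (1 + -1 * z) with (1 - z) in HS by ring.
    replace ((0 + IZR A * sqrt (1 - z) + 0 * thp) / (2 ^ 0 * IZR N ^ K))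
      with (IZR A * sqrt (1 - z) / IZR N ^ K) by (simpl; f_equal; ring).
    exact HS.
Qed.

(** Induction on the number of nodes: if two distinct nodes occur, a recurrence reduces to the forms
    lacking one copy of either; a single node is a base case, lifted to denominator [2^n]. *)
Lemma pade_form_hpad (n a b c : nat) :
  (a <= S K)%nat -> (b <= S K)%nat -> (c <= S K)%nat -> (a + b + c = S n)%nat ->
  pade_form n (hpad n b c).
Proof.
  revert a b c. induction n as [| n IH]; intros a b c Ha Hb Hc E.
  - destruct b as [| b].
    + destruct c as [| c].
      * apply pade_form_base_0; lia.
      * replace c with 0%nat by lia. apply (pade_form_base_2 0); lia.
    + replace b with 0%nat by lia. replace c with 0%nat by lia. apply (pade_form_base_1 0); lia.
  - destruct a as [| a], b as [| b], c as [| c].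
    + lia.
    + replace c with (S n) by lia. apply (pade_form_up 0); [lia |]. apply pade_form_base_2; lia.
    + replace b with (S n) by lia. apply (pade_form_up 0); [lia |]. apply pade_form_base_1; lia.
    + apply pade_form_ext with (fun h => (IZR 1 * hpad n (S b) c h + IZR (-1) * hpad n b (S c) h) / 2).
      * intros h. rewrite hpad_rec_12. field.
      * apply pade_form_comb; [lia | apply (IH 0%nat); lia | apply (IH 0%nat); lia].
    + apply (pade_form_up 0); [lia |]. apply pade_form_base_0; lia.
    + apply pade_form_ext with (fun h => (IZR 2 * hpad n 0 c h + IZR (-2) * hpad n 0 (S c) h) / 2).
      * intros h. rewrite hpad_rec_02. field.
      * apply pade_form_comb; [lia | apply (IH (S a)); lia | apply (IH a); lia].
    + apply pade_form_ext with (fun h => (IZR 2 * hpad n (S b) 0 h + IZR (-2) * hpad n b 0 h) / 2).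
      * intros h. rewrite hpad_rec_01. field.
      * apply pade_form_comb; [lia | apply (IH a); lia | apply (IH (S a)); lia].
    + apply pade_form_ext with
        (fun h => (IZR 2 * hpad n (S b) (S c) h + IZR (-2) * hpad n b (S c) h) / 2).
      * intros h. rewrite hpad_rec_01. field.
      * apply pade_form_comb; [lia | apply (IH a); lia | apply (IH (S a)); lia].
Qed.

End PadeForms.

(** * Upper and lower bounds for the linear forms *)

Lemma is_series_nonneg_term (a : nat -> R) (l : R) (n : nat) :
  (forall h, 0 <= a h) -> is_series a l -> a n <= l.
Proof.
  intros Ha Hs.
  assert (Hn : a n <= sum_n a n).
  { destruct n as [| n]; [rewrite sum_O; lra |]. rewrite sum_Sn.
    enough (0 <= sum_n a n) by (unfold plus; simpl; lra).
    induction n as [| n IH]; [rewrite sum_O; apply Ha |].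
    rewrite sum_Sn. specialize (Ha (S n)). unfold plus; simpl; lra. }
  eapply Rle_trans; [exact Hn |].
  apply (is_lim_seq_incr_compare (sum_n a)); [exact Hs |].
  intros m. rewrite sum_Sn. specialize (Ha (S m)). unfold plus; simpl; lra.
Qed.

Lemma is_series_Rabs_le (a b : nat -> R) (l m : R) :
  (forall h, Rabs (a h) <= b h) -> is_series a l -> is_series b m -> Rabs l <= m.
Proof.
  intros Hab Ha Hb.
  assert (Hab' : forall h, a h <= b h /\ - a h <= b h).
  { intros h. specialize (Hab h). apply Rabs_le_between in Hab. lra. }
  pose proof (is_series_plus_R _ _ _ _ Hb Ha) as H1.
  pose proof (is_series_plus_R _ _ _ _ Hb (is_series_scal_R (-1) _ _ Ha)) as H2.
  apply (is_series_nonneg_term _ _ 0) in H1; [| intros h; specialize (Hab' h); simpl; lra].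
  apply (is_series_nonneg_term _ _ 0) in H2; [| intros h; specialize (Hab' h); simpl; lra].
  pose proof (Hab' 0%nat). simpl in *. apply Rabs_le. lra.
Qed.

(** Each of the nodes 0, 1, -1 is taken [K + 1] times, whence [n = 3 K + 2]. The first nonzero term
    bounds the series from below, a geometric series from above. *)
Lemma pade_form_bounds (K : nat) (N : Z) :
  (16 <= N)%Z ->
  exists A B C : Z,
    let L := IZR A + IZR B * sqrt (1 - 4 / IZR N) + IZR C * sqrt (1 + 4 / IZR N) in
    Rabs (IZR B) <= 32 * (1024 * IZR N) ^ K /\ Rabs (IZR C) <= 32 * (1024 * IZR N) ^ K /\
    1 <= Rabs L * IZR N ^ (2 * K + 2) <= 1024 * 4096 ^ K.
Proof.
  intros HN. set (n := (3 * K + 2)%nat).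
  destruct (pade_form_hpad K N HN n (S K) (S K) (S K)) as (A & B & C & HB & HC & HS);
    try (unfold n; lia).
  exists A, B, C. cbv zeta. set (z := 4 / IZR N) in *.
  set (L := IZR A + IZR B * sqrt (1 - z) + IZR C * sqrt (1 + z)) in *.
  pose proof (N_ge N HN) as HN'. pose proof (z_pos N HN) as Hz. fold z in Hz.
  assert (EM : 4 ^ n * (2 * (16 * IZR N) ^ K) = 32 * (1024 * IZR N) ^ K).
  { unfold n. rewrite pow_add, pow_mult.
    replace (1024 * IZR N) with (4 ^ 3 * (16 * IZR N)) by ring.
    rewrite (Rpow_mult_distr (4 ^ 3)). ring. }
  rewrite EM in *. clear EM. repeat split; try assumption.
  - set (bn := bin (INR K + 1/2) n).
    assert (Hpos : 0 < bn * bn) by (pose proof (bin_half_neq_0 K n); unfold bn; nra).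
    assert (Hzn : 0 < z ^ n) by (apply pow_lt; lra).
    (* Multiplied by [bn], the series has only nonnegative terms: odd offsets from [n] vanish by
       [hc_diag], and at even offsets the binomial coefficients have the sign of [bn]. *)
    pose proof (is_series_scal_R bn _ _ HS) as H1.
    apply (is_series_nonneg_term _ _ n) in H1.
    + unfold term in H1. assert (Hh : hpad n (S K) (S K) n = 1)
        by (rewrite <- (Nat.add_0_r n) at 2; rewrite hpad_add; apply hc_0).
      rewrite Hh in H1. fold z bn in H1.
      set (l := L / (2 ^ n * IZR N ^ K)) in *.
      assert (H2 : Rabs bn * z ^ n <= Rabs l).
      { apply (Rmult_le_reg_l (Rabs bn)); [apply Rabs_pos_lt; intros E; rewrite E in Hpos; lra |].
        rewrite <- Rabs_mult, <- Rmult_assoc, <- Rabs_mult, (Rabs_pos_eq (bn * bn)) by lra.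
        eapply Rle_trans; [| apply Rle_abs]. lra. }
      pose proof (bin_half_lower K n) as H3. fold bn in H3.
      assert (H4 : / IZR N ^ n <= Rabs l).
      { eapply Rle_trans; [| exact H2].
        apply Rle_trans with (/ 4 ^ n * z ^ n); [| apply Rmult_le_compat_r; lra].
        unfold z, Rdiv. rewrite Rpow_mult_distr, <- Rmult_assoc, Rinv_l, pow_inv.
        - lra.
        - apply pow_nonzero; lra. }
      assert (P1 : 0 < IZR N ^ n) by (apply pow_lt; lra).
      assert (P2 : 0 < IZR N ^ K) by (apply pow_lt; lra).
      assert (P3 : 1 <= 2 ^ n) by (apply pow_R1_Rle; lra).
      unfold l in H4. unfold Rdiv in H4.
      rewrite Rabs_mult, Rabs_inv, (Rabs_pos_eq (2 ^ n * IZR N ^ K)) in H4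
        by (apply Rmult_le_pos; lra).
      assert (H5 : 2 ^ n * (IZR N ^ K / IZR N ^ n) <= Rabs L).
      { replace (2 ^ n * (IZR N ^ K / IZR N ^ n)) with (/ IZR N ^ n * (2 ^ n * IZR N ^ K))
          by (field; lra).
        replace (Rabs L) with (Rabs L * / (2 ^ n * IZR N ^ K) * (2 ^ n * IZR N ^ K))
          by (field; split; lra).
        apply Rmult_le_compat_r; [apply Rmult_le_pos; lra | exact H4]. }
      assert (P4 : 0 < IZR N ^ (2 * K + 2)) by (apply pow_lt; lra).
      apply (Rmult_le_compat_r (IZR N ^ (2 * K + 2))) in H5; [| lra].
      eapply Rle_trans; [| exact H5].
      replace (2 ^ n * (IZR N ^ K / IZR N ^ n) * IZR N ^ (2 * K + 2)) with (2 ^ n); [lra |].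
      replace (IZR N ^ n) with (IZR N ^ K * IZR N ^ (2 * K + 2))
        by (rewrite <- pow_add; f_equal; unfold n; lia).
      field. split; lra.
    + intros h. simpl. unfold term. fold z.
      destruct (Nat.lt_ge_cases h n) as [Hh | Hh]; [rewrite hpad_lt by assumption; lra |].
      replace h with (n + (h - n))%nat by lia. rewrite hpad_add.
      destruct (Nat.Even_or_Odd (h - n)) as [[e He] | [e He]]; rewrite He.
      * destruct (hc_diag (S K) e) as [H2 _].
        assert (H3 : 0 < bn * bin (INR K + 1/2) (n + 2 * e))
          by (apply bin_half_alternate; unfold n; lia).
        assert (0 < z ^ (n + 2 * e)) by (apply pow_lt; lra).
        rewrite <- !Rmult_assoc. apply Rmult_le_pos; [apply Rmult_le_pos |]; lra.
      * destruct (hc_diag (S K) e) as [_ H2]. rewrite H2. lra.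
  (* The terms from [n] on are at most [c (2 z)^(h - n)], by [bin_half_bound] and [hc_bound]; as
     [z <= 1/4], they sum to at most [2 c]. *)
  - set (c := 2 ^ S K * 2 ^ (S K + S K) * z ^ n).
    assert (Hc : 0 < c).
    { unfold c. apply Rmult_lt_0_compat; [apply Rmult_lt_0_compat |]; apply pow_lt; lra. }
    set (G := fun h => if (h <? n)%nat then 0 else c * (2 * z) ^ (h - n)).
    assert (HG : is_series G (c * / (1 - 2 * z))).
    { apply (is_series_pad _ n).
      - intros h Hh. unfold G. apply Nat.ltb_lt in Hh. now rewrite Hh.
      - eapply is_series_ext.
        2: { apply is_series_scal_R, is_series_geom. rewrite Rabs_pos_eq; lra. }
        intros d. unfold G. replace (n + d <? n)%nat with false by (symmetry; apply Nat.ltb_ge; lia).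
        simpl. do 2 f_equal. lia. }
    assert (H2 : forall h, Rabs (term K N (hpad n (S K) (S K)) h) <= G h).
    { intros h. unfold term, G. fold z. destruct (Nat.ltb_spec h n) as [Hh | Hh].
      - rewrite hpad_lt by assumption. rewrite Rmult_0_r, Rabs_R0. lra.
      - replace h with (n + (h - n))%nat at 1 2 3 by lia. rewrite hpad_add.
        set (d := (h - n)%nat).
        rewrite !Rabs_mult, (Rabs_pos_eq (z ^ _)) by (apply pow_le; lra).
        replace (c * (2 * z) ^ d)
          with (2 ^ S K * z ^ (n + d) * 2 ^ (S K + S K + d))
          by (unfold c; rewrite Rpow_mult_distr, (pow_add 2 (S K + S K)), (pow_add z); ring).
        assert (0 <= z ^ (n + d)) by (apply pow_le; lra).
        apply Rmult_le_compat; [| apply Rabs_pos | | apply hc_bound].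
        + apply Rmult_le_pos; [apply Rabs_pos | assumption].
        + apply Rmult_le_compat_r; [assumption | apply bin_half_bound]. }
    specialize (is_series_Rabs_le _ _ _ _ H2 HS HG) as H3.
    assert (P2 : 0 < IZR N ^ K) by (apply pow_lt; lra).
    assert (P3 : 0 < 2 ^ n) by (apply pow_lt; lra).
    unfold Rdiv in H3.
    rewrite Rabs_mult, Rabs_inv, (Rabs_pos_eq (2 ^ n * IZR N ^ K)) in H3
      by (apply Rmult_le_pos; lra).
    assert (H4 : c * / (1 - 2 * z) <= c * 2).
    { apply Rmult_le_compat_l; [lra |]. apply (Rmult_le_reg_r (1 - 2 * z)); [lra |].
      rewrite Rinv_l; lra. }
    assert (H5 : Rabs L <= 2 * c * (2 ^ n * IZR N ^ K)).
    { replace (Rabs L) with (Rabs L * / (2 ^ n * IZR N ^ K) * (2 ^ n * IZR N ^ K))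
        by (field; split; lra).
      apply Rmult_le_compat_r; [apply Rmult_le_pos; lra | lra]. }
    assert (P4 : 0 < IZR N ^ (2 * K + 2)) by (apply pow_lt; lra).
    apply (Rmult_le_compat_r (IZR N ^ (2 * K + 2))) in H5; [| lra].
    eapply Rle_trans; [exact H5 |]. apply Req_le.
    assert (E1 : IZR N ^ K * IZR N ^ (2 * K + 2) = IZR N ^ n)
      by (rewrite <- pow_add; f_equal; unfold n; lia).
    transitivity (2 * (2 ^ S K * 2 ^ (S K + S K)) * 2 ^ n * (z ^ n * (IZR N ^ K * IZR N ^ (2 * K + 2))));
      [unfold c; ring |].
    rewrite E1, <- Rpow_mult_distr.
    replace (z * IZR N) with (2 * 2) by (unfold z; field; lra).
    (* Since [z N = 4], everything is a power of 2, with exponent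
       [1 + 3 (K + 1) + 3 n = 12 K + 10]. *)
    transitivity (2 ^ (1 + (S K + (S K + S K)) + n + 2 * n)).
    { rewrite !(pow_add 2), (pow_mult 2 2 n). simpl (2 ^ 1). simpl (2 ^ 2).
      rewrite !Rmult_1_r. ring. }
    transitivity (2 ^ (10 + 12 * K)); [f_equal; unfold n; lia |].
    rewrite pow_add, pow_mult. simpl (2 ^ 10). simpl (2 ^ 12). f_equal; [ring | f_equal; ring].
Qed.

(** * Solutions with opposite signs *)

Lemma exists_power_bracket (r t : R) :
  1 < r -> 1 <= t -> exists K : nat, r ^ K <= t < r ^ S K.
Proof.
  intros Hr Ht.
  destruct (Pow_x_infinity r) with (b := t + 1) as [m Hm]; [rewrite Rabs_pos_eq; lra |].
  specialize (Hm m (le_n m)). rewrite Rabs_pos_eq in Hm by (apply pow_le; lra).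
  assert (H : t < r ^ m) by lra. clear Hm.
  induction m as [| m IH]; [simpl in H; lra |].
  destruct (Rlt_le_dec t (r ^ m)) as [H1 | H1]; [now apply IH | now exists m].
Qed.

(** The base [2^34 = 1024 * 4096^2] collects the constants of [pade_form_bounds]. At [K = 4] the
    left side is [2^145 N^3], hence the threshold [2^146]; each further step multiplies it by less
    than [N]. *)
Lemma power_dominates (N : R) (K : nat) :
  2 ^ 146 <= N -> (4 <= K)%nat -> 512 * N ^ 3 * (2 ^ 34) ^ K < N ^ K.
Proof.
  intros HN HK. replace K with (4 + (K - 4))%nat by lia. set (j := (K - 4)%nat).
  assert (H0 : 0 < 2 ^ 34) by (apply pow_lt; lra).
  assert (H1 : 2 ^ 34 <= 2 ^ 146) by (apply Rle_pow; [lra | lia]).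
  assert (H2 : (2 ^ 34) ^ j <= N ^ j) by (apply pow_incr; lra).
  assert (H3 : 0 < N ^ j) by (apply pow_lt; lra).
  assert (H4 : 0 < N ^ 3) by (apply pow_lt; lra).
  assert (H5 : 512 * (2 ^ 34) ^ 4 < N).
  { eapply Rlt_le_trans; [| exact HN]. rewrite <- pow_mult. simpl. lra. }
  rewrite !pow_add.
  assert (H6 : 0 < (2 ^ 34) ^ 4) by (apply pow_lt; lra).
  apply Rle_lt_trans with (N ^ 3 * (512 * (2 ^ 34) ^ 4) * N ^ j).
  - replace (512 * N ^ 3 * ((2 ^ 34) ^ 4 * (2 ^ 34) ^ j))
      with (N ^ 3 * (512 * (2 ^ 34) ^ 4) * (2 ^ 34) ^ j) by ring.
    apply Rmult_le_compat_l; [| assumption]. apply Rmult_le_pos; lra.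
  - replace (N ^ 4 * N ^ j) with (N ^ 3 * N * N ^ j) by ring.
    apply Rmult_lt_compat_r; [assumption |]. apply Rmult_lt_compat_l; lra.
Qed.

Lemma sqrt_pell_gap (d x y e : R) :
  0 < d -> 0 < x -> 0 <= y -> x * x - d * (y * y) = e ->
  Rabs (x - sqrt d * y) <= Rabs e / x.
Proof.
  intros Hd Hx Hy E. pose proof (sqrt_lt_R0 d Hd) as Hs.
  pose proof (sqrt_sqrt d (Rlt_le _ _ Hd)) as Hss.
  assert (0 <= sqrt d * y) by (apply Rmult_le_pos; lra).
  apply Rle_div_r; [assumption |].
  replace e with ((x - sqrt d * y) * (x + sqrt d * y))
    by (transitivity (x * x - (sqrt d * sqrt d) * (y * y)); [ring | now rewrite Hss]).
  rewrite Rabs_mult. apply Rmult_le_compat_l; [apply Rabs_pos |].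
  rewrite Rabs_pos_eq; lra.
Qed.

Lemma small_solution_sqrt (d x0 y0 e : R) :
  0 < d -> 0 < x0 -> 0 <= y0 -> x0 * x0 - d * (y0 * y0) = e ->
  sqrt (1 - e / (x0 * x0)) = y0 * sqrt d / x0.
Proof.
  intros Hd Hx Hy E. pose proof (sqrt_lt_R0 d Hd) as Hs.
  replace (1 - e / (x0 * x0)) with ((y0 * sqrt d / x0) * (y0 * sqrt d / x0)).
  - apply sqrt_square. apply Rdiv_le_0_compat; [| assumption]. apply Rmult_le_pos; lra.
  - transitivity (y0 * y0 * (sqrt d * sqrt d) / (x0 * x0)); [field; lra |].
    rewrite sqrt_sqrt, <- E by lra. field; lra.
Qed.

(** The difference factors as [y0 sqrt d (x - sqrt d y)], where the first factor is at most [2 x0]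
    and the second at most [4 / x] in absolute value. *)
Lemma product_gap (d x0 y0 x y e : R) :
  0 < d -> 4 <= x0 -> 0 < x -> 0 <= y0 -> 0 <= y -> Rabs e = 4 ->
  x0 * x0 - d * (y0 * y0) = e -> x * x - d * (y * y) = e ->
  Rabs (x * x0 * sqrt (1 - e / (x0 * x0)) - d * y * y0) <= 8 * x0 / x.
Proof.
  intros Hd Hx0 Hx Hy0 Hy He E0 E.
  rewrite (small_solution_sqrt d x0 y0 e) by (assumption || lra).
  pose proof (sqrt_lt_R0 d Hd) as Hs. pose proof (sqrt_sqrt d (Rlt_le _ _ Hd)) as Hss.
  replace (x * x0 * (y0 * sqrt d / x0) - d * y * y0) with (y0 * sqrt d * (x - sqrt d * y))

    by (transitivity (x * (y0 * sqrt d) - (sqrt d * sqrt d) * y * y0); [ring | rewrite Hss; field; lra]).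
  pose proof (sqrt_pell_gap d x y e Hd Hx Hy E) as H1. rewrite He in H1.
  assert (Hp : 0 <= y0 * sqrt d) by (apply Rmult_le_pos; lra).
  assert (H2 : y0 * sqrt d <= 2 * x0).
  { assert (y0 * sqrt d * (y0 * sqrt d) <= 2 * x0 * (2 * x0)).
    - replace (y0 * sqrt d * (y0 * sqrt d)) with (d * (y0 * y0))
        by (transitivity ((sqrt d * sqrt d) * (y0 * y0)); [now rewrite Hss | ring]).
      assert (- e <= 4) by (rewrite <- He, <- Rabs_Ropp; apply Rle_abs). nra.
    - apply Rnot_lt_le; intros ?. nra. }
  rewrite Rabs_mult, (Rabs_pos_eq _ Hp).
  replace (8 * x0 / x) with (2 * x0 * (4 / x)) by (field; lra).
  apply Rmult_le_compat; auto. apply Rabs_pos.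
Qed.

(* If [x] is at least [x0 ^ 16], then for a suitable [K] the integer
   [A x x0 + B D1 y y0 + C D2 z z0], which is close to [x x0 L], is smaller than [1], hence zero;
   then [x x0 L] is smaller than the lower bound on [L] permits. *)
Lemma no_distant_solutions (D1 D2 x0 y0 z0 x y z : Z) :
  (0 < D1)%Z -> (0 < D2)%Z -> (0 <= y0)%Z -> (0 <= z0)%Z -> (0 <= y)%Z -> (0 <= z)%Z ->
  (x0 * x0 - D1 * (y0 * y0) = 4)%Z -> (x0 * x0 - D2 * (z0 * z0) = -4)%Z ->
  (x * x - D1 * (y * y) = 4)%Z -> (x * x - D2 * (z * z) = -4)%Z ->
  (2 ^ 73 <= x0)%Z -> (x0 ^ 16 <= x)%Z -> False.
Proof.
  intros HD1 HD2 Hy0 Hz0 Hy Hz E1 E2 E3 E4 Hx0 Hx.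
  set (N := (x0 * x0)%Z).
  assert (HN0 : (2 ^ 146 <= N)%Z).
  { unfold N. replace (2 ^ 146)%Z with (2 ^ 73 * 2 ^ 73)%Z by reflexivity.
    apply Z.mul_le_mono_nonneg; lia. }
  assert (H2x : (2 ^ 73 <= x)%Z).
  { eapply Z.le_trans; [exact Hx0 |]. eapply Z.le_trans; [| exact Hx].
    rewrite <- (Z.pow_1_r x0) at 1. apply Z.pow_le_mono_r; lia. }
  apply IZR_le in Hx0, Hx, HN0, H2x, Hy0, Hz0, Hy, Hz. apply IZR_lt in HD1, HD2.
  apply (f_equal IZR) in E1, E2, E3, E4.
  rewrite minus_IZR, !mult_IZR in E1, E2, E3, E4.
  change 16%Z with (Z.of_nat 16) in Hx. rewrite <- pow_IZR in Hx.
  change 73%Z with (Z.of_nat 73) in Hx0, H2x. rewrite <- pow_IZR in Hx0, H2x.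
  change 146%Z with (Z.of_nat 146) in HN0. rewrite <- pow_IZR in HN0.
  set (X0 := IZR x0) in *. set (X := IZR x) in *.
  assert (EN : IZR N = X0 * X0) by (unfold N; apply mult_IZR).
  assert (H273 : 2 ^ 4 <= 2 ^ 73) by (apply Rle_pow; [lra | lia]).
  assert (H2146 : 2 ^ 14 <= 2 ^ 146) by (apply Rle_pow; [lra | lia]).
  replace (2 ^ 4) with 16 in H273 by ring. replace (2 ^ 14) with 16384 in H2146 by ring.
  set (n := IZR N) in *.
  pose proof (fun k => power_dominates n k HN0) as Hdom0.
  assert (Hn : 16384 <= n) by lra. assert (HX0 : 16 <= X0) by lra. assert (HX : 16 <= X) by lra.
  clear Hx0 HN0 H2x H273 H2146.
  assert (Hnn0 : 16384 * 16384 <= n * n) by (apply Rmult_le_compat; lra).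
  assert (HXX : X * 16 <= X * X0) by (apply Rmult_le_compat_l; lra).
  (* [K] is chosen with [r^K <= x x0 < r^(K+1)]: the upper bound makes [x x0 |L|] less than 1/4, the
     lower one makes the approximation error less than 1/4. *)
  set (r := n * n / 4096).
  assert (HR : 1 < r) by (unfold r; apply (proj1 (Rlt_div_r 1 (n * n) 4096 ltac:(lra))); lra).
  destruct (exists_power_bracket r (X * X0) HR) as (K & HK1 & HK2); [lra |].
  (* Otherwise [x x0 < r^4 <= N^8 = x0^16 <= x]. *)
  assert (HK : (4 <= K)%nat).
  { apply Nat.nlt_ge. intros Hlt.
    assert (H1 : r ^ S K <= r ^ 4) by (apply Rle_pow; [lra | lia]).
    assert (H2 : r ^ 4 <= (n * n) ^ 4).
    { apply pow_incr. split; [lra |]. unfold r. apply Rle_div_l; lra. }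
    assert (H3 : (n * n) ^ 4 = X0 ^ 16) by (rewrite EN; ring).
    lra. }
  pose proof (Hdom0 K HK) as Hdom. clear Hdom0.
  destruct (pade_form_bounds K N) as (A & B & C & HB & HC & HL1 & HL2).
  { apply le_IZR. fold n. lra. }
  fold n in HB, HC, HL1, HL2.
  set (thm := sqrt (1 - 4 / n)) in *. set (thp := sqrt (1 + 4 / n)) in *.
  set (L := IZR A + IZR B * thm + IZR C * thp) in *.
  assert (G1 : Rabs (X * X0 * thm - IZR D1 * IZR y * IZR y0) <= 8 * X0 / X).
  { unfold thm. rewrite EN. apply product_gap; auto; try lra. rewrite Rabs_pos_eq; lra. }
  assert (G2 : Rabs (X * X0 * thp - IZR D2 * IZR z * IZR z0) <= 8 * X0 / X).
  { unfold thp. rewrite EN. replace (1 + 4 / (X0 * X0)) with (1 - -4 / (X0 * X0)) by (field; lra).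
    apply product_gap; auto; try lra. rewrite Rabs_left; lra. }
  set (e1 := X * X0 * thm - IZR D1 * IZR y * IZR y0) in *.
  set (e2 := X * X0 * thp - IZR D2 * IZR z * IZR z0) in *.
  set (M := (A * (x * x0) + B * (D1 * y * y0) + C * (D2 * z * z0))%Z).
  assert (EM : X * X0 * L = IZR M + (IZR B * e1 + IZR C * e2)).
  { unfold M, L, e1, e2. rewrite !plus_IZR, !mult_IZR. fold X X0. ring. }
  set (a := n ^ K) in *. set (p := 1024 ^ K). set (q := 4096 ^ K) in *.
  assert (Ha : 1 <= a) by (apply pow_R1_Rle; lra).
  assert (Hp : 1 <= p) by (apply pow_R1_Rle; lra).
  assert (Hq : 1 <= q) by (apply pow_R1_Rle; lra).
  assert (Hpq : p * q * q = (2 ^ 34) ^ K).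
  { unfold p, q. rewrite <- !Rpow_mult_distr. f_equal. ring. }
  rewrite <- Hpq in Hdom.
  rewrite Rpow_mult_distr in HB, HC. fold p a in HB, HC.
  assert (ERK : r ^ K * q = a * a).
  { unfold r, q, a. rewrite <- !Rpow_mult_distr. f_equal. field. }
  assert (EN2 : n ^ (2 * K + 2) = a * a * (n * n)).
  { unfold a. rewrite pow_add, (Nat.mul_comm 2), pow_mult. ring. }
  rewrite EN2 in HL1, HL2.
  set (T := X * X0) in *.
  assert (HT : a * a <= T * q) by (rewrite <- ERK; apply Rmult_le_compat_r; lra).
  assert (HT2 : T * q * 4096 < a * a * (n * n)).
  { rewrite <- ERK. simpl (r ^ S K) in HK2. unfold r in HK2 at 1.
    apply (Rmult_lt_compat_r (q * 4096)) in HK2; [| nra].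
    replace (n * n / 4096 * r ^ K * (q * 4096)) with (r ^ K * q * (n * n)) in HK2 by field. lra. }
  assert (Hsmall : Rabs (IZR B * e1 + IZR C * e2) * T <= 512 * (p * a) * n).
  { assert (H1 : Rabs (IZR B * e1 + IZR C * e2) <= 32 * (p * a) * (8 * X0 / X) * 2).
    { eapply Rle_trans; [apply Rabs_triang |]. rewrite !Rabs_mult.
      assert (H1 : Rabs (IZR B) * Rabs e1 <= 32 * (p * a) * (8 * X0 / X))
        by (apply Rmult_le_compat; auto using Rabs_pos).
      assert (H2 : Rabs (IZR C) * Rabs e2 <= 32 * (p * a) * (8 * X0 / X))
        by (apply Rmult_le_compat; auto using Rabs_pos). lra. }
    apply (Rmult_le_compat_r T) in H1; [| lra].
    eapply Rle_trans; [exact H1 |]. apply Req_le. rewrite EN. unfold T. field. lra. }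
  set (E := IZR B * e1 + IZR C * e2) in *.
  assert (HTpos : 0 < T) by (lra).
  assert (Hn3 : n <= n ^ 3) by (rewrite <- (pow_1 n) at 1; apply Rle_pow; [lra | lia]).
  assert (Haa : 0 < a * a) by nra. assert (Hnn : 0 < n * n) by nra.
  assert (HE : Rabs E < 1/4).
  { apply (Rmult_lt_reg_r (T * q)); [apply Rmult_lt_0_compat; lra |].
    apply Rle_lt_trans with (512 * (p * q * n) * a).
    - replace (Rabs E * (T * q)) with (Rabs E * T * q) by ring.
      replace (512 * (p * q * n) * a) with (512 * (p * a) * n * q) by ring.
      apply Rmult_le_compat_r; lra.
    - apply Rlt_le_trans with (1/4 * (a * a)); [| apply Rmult_le_compat_l; lra].
      replace (1/4 * (a * a)) with (1/4 * a * a) by ring. apply Rmult_lt_compat_r; [lra |].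
      assert (Hpqn : 0 < p * q * n) by (repeat apply Rmult_lt_0_compat; lra).
      assert (H4 : 4 * 1 <= n * n * q) by (apply Rmult_le_compat; nra).
      replace (512 * n ^ 3 * (p * q * q)) with (512 * (p * q * n) * (n * n * q)) in Hdom by ring.
      nra. }
  assert (HTL : T * Rabs L < 1/4).
  { apply (Rmult_lt_reg_r (a * a * (n * n))); [nra |].
    apply Rle_lt_trans with (T * (1024 * q)); [| lra].
    replace (T * Rabs L * (a * a * (n * n))) with (T * (Rabs L * (a * a * (n * n)))) by ring.
    apply Rmult_le_compat_l; lra. }
  assert (HM : M = 0%Z).
  { enough (Z.abs M < 1)%Z by lia. apply lt_IZR. rewrite abs_IZR.
    replace (IZR M) with (T * L - E) by lra.
    eapply Rle_lt_trans; [apply Rabs_triang |].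
    rewrite Rabs_Ropp, Rabs_mult, (Rabs_pos_eq T); lra. }
  rewrite HM, Rplus_0_l in EM. rewrite <- EM, Rabs_mult, (Rabs_pos_eq T) in Hsmall by lra.
  (* As [M = 0], the error [E] equals [T L], and the lower bound on [L] limits [T]. With
     [a^2 <= T q] this yields [a <= 512 p q^2 n^3], against [power_dominates]. *)
  assert (H1 : T * T <= 512 * (p * a) * n * (a * a * (n * n))).
  { apply Rle_trans with (T * Rabs L * T * (a * a * (n * n))).
    - replace (T * Rabs L * T * (a * a * (n * n))) with (T * T * (Rabs L * (a * a * (n * n)))) by ring.
      rewrite <- (Rmult_1_r (T * T)) at 1. apply Rmult_le_compat_l; nra.
    - apply Rmult_le_compat_r; [nra | exact Hsmall]. }
  assert (H2 : a * a * (a * a) <= T * q * (T * q)) by (apply Rmult_le_compat; lra).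
  apply (Rmult_le_compat_r (q * q)) in H1; [| nra].
  assert (Ha3 : 0 < a * a * a) by (repeat apply Rmult_lt_0_compat; lra).
  apply (Rmult_lt_compat_r (a * a * a)) in Hdom; [| assumption].
  simpl in Hdom. lra.
Qed.

(** * Gap between two common values of opposite signs *)

Lemma ln_pow_INR (a : R) (n : nat) : 1 < a -> ln (a ^ n) = INR n * ln a.
Proof. intros Ha. rewrite <- Rpower_pow by lra. unfold Rpower. apply ln_exp. Qed.

Lemma exp_INR_mul (n : nat) (t : R) : exp (INR n * t) = exp t ^ n.
Proof. rewrite <- Rpower_pow by apply exp_pos. unfold Rpower. now rewrite ln_exp. Qed.

(** The logarithm of [be^m / al^n] is positive, decreases from the first solution to the second, and
    is at most [2 / al^(2 n1)] at the first. Eliminating [ln be] between the two leaves a positive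
    integer multiple of [ln al], which forces [m2] to be large. *)
Lemma exponent_gap (al be x1 x2 : R) (n1 m1 n2 m2 : nat) :
  1 < al -> 1 < be -> 2 < x1 -> x1 < x2 ->
  al ^ n1 + / al ^ n1 = x1 -> be ^ m1 - / be ^ m1 = x1 ->
  al ^ n2 + / al ^ n2 = x2 -> be ^ m2 - / be ^ m2 = x2 ->
  ln al * (x1 * x1) <= 8 * INR m2.
Proof.
  intros Ha Hb Hx1 Hx EX1 EY1 EX2 EY2.
  assert (PX1 : 1 <= al ^ n1) by (apply pow_R1_Rle; lra).
  assert (PX2 : 1 <= al ^ n2) by (apply pow_R1_Rle; lra).
  assert (PY1 : 1 <= be ^ m1) by (apply pow_R1_Rle; lra).
  assert (PY2 : 1 <= be ^ m2) by (apply pow_R1_Rle; lra).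
  pose proof (ln_pow_INR al n1 Ha) as LX1. pose proof (ln_pow_INR al n2 Ha) as LX2.
  pose proof (ln_pow_INR be m1 Hb) as LY1. pose proof (ln_pow_INR be m2 Hb) as LY2.
  set (X1 := al ^ n1) in *. set (X2 := al ^ n2) in *.
  set (Y1 := be ^ m1) in *. set (Y2 := be ^ m2) in *.
  assert (inv1 : forall t, 1 <= t -> 0 < / t <= 1).
  { intros t Ht. split; [apply Rinv_0_lt_compat; lra |]. rewrite <- Rinv_1. apply Rinv_le_contravar; lra. }
  assert (anti : forall s t, 1 <= s -> s <= t -> / t <= / s)
    by (intros s t Hs Ht; apply Rinv_le_contravar; lra).
  assert (HXlt : X1 < X2).
  { apply Rnot_le_lt; intros H.
    assert (H1 : X2 + / X2 <= X1 + / X1).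
    { assert (E : X1 + / X1 - (X2 + / X2) = (X1 - X2) * (1 - / X1 * / X2)) by (field; lra).
      pose proof (inv1 X1 PX1). pose proof (inv1 X2 PX2).
      assert (0 <= (X1 - X2) * (1 - / X1 * / X2)) by (apply Rmult_le_pos; nra). lra. }
    lra. }
  assert (HYlt : Y1 < Y2).
  { apply Rnot_le_lt; intros H. pose proof (anti Y2 Y1 PY2 H). lra. }
  set (r1 := Y1 / X1). set (r2 := Y2 / X2).
  assert (Er1 : r1 = 1 + (/ X1 + / Y1) * / X1).
  { unfold r1. replace Y1 with (X1 + (/ X1 + / Y1)) at 1 by lra. field. lra. }
  assert (Er2 : r2 = 1 + (/ X2 + / Y2) * / X2).
  { unfold r2. replace Y2 with (X2 + (/ X2 + / Y2)) at 1 by lra. field. lra. }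
  assert (HX1Y1 : X1 <= Y1) by (pose proof (inv1 X1 PX1); pose proof (inv1 Y1 PY1); lra).
  assert (iX : / X2 < / X1) by (apply Rinv_lt_contravar; [apply Rmult_lt_0_compat |]; lra).
  assert (iY : / Y2 < / Y1) by (apply Rinv_lt_contravar; [apply Rmult_lt_0_compat |]; lra).
  pose proof (inv1 X1 PX1) as iX1. pose proof (inv1 X2 PX2) as iX2.
  pose proof (inv1 Y1 PY1) as iY1. pose proof (inv1 Y2 PY2) as iY2.
  assert (Hr2 : 1 < r2).
  { rewrite Er2. assert (0 < (/ X2 + / Y2) * / X2) by (apply Rmult_lt_0_compat; lra). lra. }
  assert (Hr12 : r2 < r1).
  { rewrite Er1, Er2. apply Rplus_lt_compat_l. apply Rmult_le_0_lt_compat; lra. }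
  assert (Hl2 : 0 < ln r2) by (rewrite <- ln_1; apply ln_increasing; lra).
  assert (Hl12 : ln r2 < ln r1) by (apply ln_increasing; lra).
  assert (Hl1 : ln r1 * (X1 * X1) <= 2).
  { assert (H1 : r1 <= exp (2 * (/ X1 * / X1))).
    { apply Rle_trans with (1 + 2 * (/ X1 * / X1)); [| apply exp_ineq1_le].
      rewrite Er1. pose proof (anti X1 Y1 PX1 HX1Y1). nra. }
    assert (H2 : ln r1 <= 2 * (/ X1 * / X1)) by (rewrite <- (ln_exp (2 * _)); apply ln_le; lra).
    apply (Rmult_le_compat_r (X1 * X1)) in H2; [| nra].
    replace (2 * (/ X1 * / X1) * (X1 * X1)) with 2 in H2 by (field; lra). exact H2. }
  assert (El1 : ln r1 = INR m1 * ln be - INR n1 * ln al)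
    by (unfold r1; rewrite ln_div, LX1, LY1; lra).
  assert (El2 : ln r2 = INR m2 * ln be - INR n2 * ln al)
    by (unfold r2; rewrite ln_div, LX2, LY2; lra).
  assert (Hla : 0 < ln al) by (rewrite <- ln_1; apply ln_increasing; lra).
  assert (Hlb : 0 < ln be) by (rewrite <- ln_1; apply ln_increasing; lra).
  assert (Hm : INR m1 < INR m2).
  { assert (ln Y1 < ln Y2) by (apply ln_increasing; lra). nra. }
  pose proof (pos_INR m1) as Hm1.
  assert (Hdet : INR m2 * ln r1 - INR m1 * ln r2
                 = IZR (Z.of_nat m1 * Z.of_nat n2 - Z.of_nat m2 * Z.of_nat n1) * ln al).
  { rewrite minus_IZR, !mult_IZR, <- !INR_IZR_INZ, El1, El2. ring. }
  assert (Hdpos : 0 < INR m2 * ln r1 - INR m1 * ln r2).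
  { assert (INR m1 * ln r2 <= INR m1 * ln r1) by (apply Rmult_le_compat_l; lra).
    assert (INR m1 * ln r1 < INR m2 * ln r1) by (apply Rmult_lt_compat_r; lra). lra. }
  set (d := (Z.of_nat m1 * Z.of_nat n2 - Z.of_nat m2 * Z.of_nat n1)%Z) in *.
  assert (Hd : 1 <= IZR d).
  { apply IZR_le. enough (0 < d)%Z by lia. apply lt_IZR.
    apply (Rmult_lt_reg_r (ln al)); [assumption |]. rewrite Rmult_0_l. lra. }
  assert (H1 : ln al <= INR m2 * ln r1).
  { assert (1 * ln al <= IZR d * ln al) by (apply Rmult_le_compat_r; lra).
    assert (0 <= INR m1 * ln r2) by (apply Rmult_le_pos; lra). lra. }
  apply (Rmult_le_compat_r (X1 * X1)) in H1; [| nra].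
  assert (H2 : INR m2 * (ln r1 * (X1 * X1)) <= INR m2 * 2) by (apply Rmult_le_compat_l; lra).
  assert (H3 : x1 * x1 <= 2 * X1 * (2 * X1)) by (apply Rmult_le_compat; lra).
  apply (Rmult_le_compat_l (ln al)) in H3; [| lra]. lra.
Qed.

(** By [exponent_gap], [m2] is at least a constant times [x1^2], and [exp t >= (1 + t / 9)^9] turns
    this into a constant times [x1^18]. Two of the factors [x1] absorb the constants. *)
Lemma solution_gap (al be : R) :
  1 < al -> 1 < be ->
  exists T : R, forall x1 x2 n1 m1 n2 m2, T <= x1 -> x1 < x2 ->
    al ^ n1 + / al ^ n1 = x1 -> be ^ m1 - / be ^ m1 = x1 ->
    al ^ n2 + / al ^ n2 = x2 -> be ^ m2 - / be ^ m2 = x2 -> x1 ^ 16 <= x2.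
Proof.
  intros Ha Hb.
  assert (Hla : 0 < ln al) by (rewrite <- ln_1; apply ln_increasing; lra).
  assert (Hlb : 0 < ln be) by (rewrite <- ln_1; apply ln_increasing; lra).
  (* Here 72 is the 8 of [exponent_gap] times the exponent 9. *)
  set (k := ln al * ln be / 72).
  assert (Hk : 0 < k) by (unfold k; apply Rdiv_lt_0_compat; [now apply Rmult_lt_0_compat | lra]).
  assert (Hk9 : 0 < k ^ 9) by now apply pow_lt.
  assert (Hik : 0 < / k ^ 9) by now apply Rinv_0_lt_compat.
  (* The first summand ensures [k^9 x1 >= 2]; the 3 ensures [x1 > 2], as [exponent_gap] requires. *)
  exists (2 * / k ^ 9 + 3). intros x1 x2 n1 m1 n2 m2 HT Hx EX1 EY1 EX2 EY2.
  assert (Hm : ln al * (x1 * x1) <= 8 * INR m2)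
    by (eapply (exponent_gap al be x1 x2 n1 m1 n2 m2); eauto; lra).
  assert (PY2 : 1 <= be ^ m2) by (apply pow_R1_Rle; lra).
  assert (HY : k ^ 9 * (x1 * x1) ^ 9 <= be ^ m2).
  { rewrite <- (exp_ln (be ^ m2)), ln_pow_INR by lra.
    replace (INR m2 * ln be) with (INR 9 * (INR m2 * ln be / 9)) by (simpl; field).
    rewrite exp_INR_mul, <- Rpow_mult_distr. apply pow_incr. split.
    - apply Rmult_le_pos; nra.
    - apply Rle_trans with (1 + INR m2 * ln be / 9); [| apply exp_ineq1_le].
      apply (Rmult_le_compat_r (ln be)) in Hm; [| lra]. unfold k. lra. }
  assert (H1 : 2 <= k ^ 9 * x1).
  { replace 2 with (k ^ 9 * (2 * / k ^ 9)) by (field; lra). apply Rmult_le_compat_l; lra. }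
  assert (H16 : 0 < x1 ^ 16) by (apply pow_lt; lra).
  assert (H2 : 2 * x1 ^ 16 <= be ^ m2).
  { eapply Rle_trans; [| exact HY].
    replace (k ^ 9 * (x1 * x1) ^ 9) with (k ^ 9 * x1 * x1 * x1 ^ 16) by ring.
    apply Rmult_le_compat_r; [lra |]. nra. }
  assert (H3 : / be ^ m2 <= 1) by (rewrite <- Rinv_1; apply Rinv_le_contravar; lra).
  assert (H4 : 1 <= x1 ^ 16) by (apply pow_R1_Rle; lra). lra.
Qed.

(** * Closed forms and the bound for opposite signs *)

Definition root_p (P Q : Z) : R := (IZR P + sqrt (IZR (discr P Q))) / 2.
Definition root_m (P Q : Z) : R := (IZR P - sqrt (IZR (discr P Q))) / 2.

Lemma root_prod (P Q : Z) : (0 < discr P Q)%Z -> root_p P Q * root_m P Q = IZR Q.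
Proof.
  intros HD. apply IZR_lt in HD. pose proof (sqrt_sqrt _ (Rlt_le _ _ HD)) as E.
  transitivity ((IZR P * IZR P - sqrt (IZR (discr P Q)) * sqrt (IZR (discr P Q))) / 4);
    [unfold root_p, root_m; field |].
  rewrite E. unfold discr. rewrite minus_IZR, !mult_IZR. field.
Qed.

Lemma lucasV_binet (P Q : Z) (n : nat) :
  (0 < discr P Q)%Z -> IZR (lucasV P Q n) = root_p P Q ^ n + root_m P Q ^ n.
Proof.
  intros HD. pose proof (root_prod P Q HD) as Hprod.
  assert (Hsum : root_p P Q + root_m P Q = IZR P) by (unfold root_p, root_m; field).
  induction n as [| | n IH1 IH2] using two_step_ind.
  - simpl. ring.
  - change (lucasV P Q 1) with P. rewrite <- Hsum. simpl. ring.
  - rewrite lucasV_SS, minus_IZR, !mult_IZR, IH1, IH2, <- Hsum, <- Hprod. simpl. ring.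
Qed.

Lemma lucasV_root (P Q : Z) (n : nat) :
  (0 < discr P Q)%Z -> root_p P Q <> 0 ->
  IZR (lucasV P Q n) = root_p P Q ^ n + IZR (Q ^ Z.of_nat n) * / root_p P Q ^ n.
Proof.
  intros HD H0. rewrite (lucasV_binet P Q n HD), <- pow_IZR, <- (root_prod P Q HD).
  rewrite Rpow_mult_distr. field. now apply pow_nonzero.
Qed.

Lemma root_p_gt_1 (P Q : Z) : regular P Q -> 1 < root_p P Q.
Proof.
  intros R. assert (H : (1 < discr P Q)%Z /\ (1 <= P)%Z)
    by (unfold discr; destruct R as [[-> ?] | [-> ?]]; nia).
  destruct H as [HD HP]. apply IZR_lt in HD. apply IZR_le in HP.
  assert (1 < sqrt (IZR (discr P Q))) by (rewrite <- sqrt_1; apply sqrt_lt_1; lra).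
  unfold root_p. lra.
Qed.

(** If some solution [x0] exceeds the threshold [T'], it bounds all others: a larger one would be at
    least [x0^16] by [solution_gap], which [no_distant_solutions] excludes. Otherwise [T'] is a
    bound. *)
Lemma mixed_sign_bounded (P1 Q1 P2 Q2 : Z) :
  regular P1 Q1 -> regular P2 Q2 ->
  exists B : Z, forall n m, lucasV P1 Q1 n = lucasV P2 Q2 m ->
    (Q1 ^ Z.of_nat n = 1)%Z -> (Q2 ^ Z.of_nat m = -1)%Z -> (lucasV P1 Q1 n <= B)%Z.
Proof.
  intros R1 R2.
  pose proof (regular_discr _ _ R1) as D1. pose proof (regular_discr _ _ R2) as D2.
  pose proof (root_p_gt_1 _ _ R1) as G1. pose proof (root_p_gt_1 _ _ R2) as G2.
  destruct (solution_gap _ _ G1 G2) as [T HT].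
  set (T' := Z.max (up T) (2 ^ 73)).
  set (sol := fun n m => lucasV P1 Q1 n = lucasV P2 Q2 m /\
    (Q1 ^ Z.of_nat n = 1)%Z /\ (Q2 ^ Z.of_nat m = -1)%Z).
  destruct (classic (exists n m, sol n m /\ (T' <= lucasV P1 Q1 n)%Z))
    as [(n1 & m1 & (E1 & S1 & S1') & H1) | Hno].
  - exists (lucasV P1 Q1 n1). intros n2 m2 E2 S2 S2'.
    apply Z.nlt_ge; intros Hlt.
    assert (Hreal : (lucasV P1 Q1 n1 ^ 16 <= lucasV P1 Q1 n2)%Z).
    { apply le_IZR. change 16%Z with (Z.of_nat 16). rewrite <- pow_IZR.
      apply (HT _ _ n1 m1 n2 m2).
      - destruct (archimed T) as [Hup _].
        apply Rle_trans with (IZR (up T)); [lra |]. apply IZR_le. lia.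
      - now apply IZR_lt.
      - rewrite (lucasV_root P1 Q1), S1 by (assumption || lra). ring.
      - rewrite E1, (lucasV_root P2 Q2), S1' by (assumption || lra). ring.
      - rewrite (lucasV_root P1 Q1), S2 by (assumption || lra). ring.
      - rewrite E2, (lucasV_root P2 Q2), S2' by (assumption || lra). ring. }
    pose proof (lucas_pell P1 Q1 n1) as L1. pose proof (lucas_pell P2 Q2 m1) as L2.
    pose proof (lucas_pell P1 Q1 n2) as L3. pose proof (lucas_pell P2 Q2 m2) as L4.
    rewrite S1 in L1. rewrite S1', <- E1 in L2. rewrite S2 in L3. rewrite S2', <- E2 in L4.
    apply (no_distant_solutions (discr P1 Q1) (discr P2 Q2) (lucasV P1 Q1 n1)
      (Z.abs (lucasU P1 Q1 n1)) (Z.abs (lucasU P2 Q2 m1)) (lucasV P1 Q1 n2)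
      (Z.abs (lucasU P1 Q1 n2)) (Z.abs (lucasU P2 Q2 m2)));
      rewrite ?Z.abs_square; try assumption; try apply Z.abs_nonneg.
    eapply Z.le_trans; [apply Z.le_max_r | exact H1].
  - exists T'. intros n m E S S'. apply Z.nlt_ge; intros Hlt. apply Hno.
    exists n, m. repeat split; auto. lia.
Qed.

Open Scope Z_scope.

(** * The intersection *)

(** After division by the gcd, [b'] is coprime to [a'] and divides its square, hence is a unit. *)
Lemma square_of_mul_square (a b D : Z) :
  b <> 0 -> a * a = D * (b * b) -> is_square D.
Proof.
  intros Hb E. set (g := Z.gcd a b).
  assert (Hg : g <> 0) by (unfold g; intros H; apply Z.gcd_eq_0_r in H; auto).
  destruct (Z.gcd_divide_l a b) as [a' Ha]. destruct (Z.gcd_divide_r a b) as [b' Hb'].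
  fold g in Ha, Hb'.
  assert (E' : a' * a' = D * (b' * b')).
  { apply (Z.mul_reg_r _ _ (g * g)); [nia |].
    transitivity (a * a); [rewrite Ha; ring | rewrite E, Hb'; ring]. }
  assert (Hc : Z.gcd b' a' = 1).
  { rewrite Z.gcd_comm. apply (Z.mul_reg_r _ _ (Z.abs g)); [lia |].
    rewrite <- Z.gcd_mul_mono_r, <- Ha, <- Hb'. fold g.
    unfold g. rewrite Z.abs_eq by apply Z.gcd_nonneg. ring. }
  assert (H1 : (b' | 1)).
  { apply (Z.gauss b' a' 1); [| exact Hc]. rewrite Z.mul_1_r.
    apply (Z.gauss b' a' a'); [| exact Hc]. exists (D * b'). rewrite E'. ring. }
  exists a'. apply Z.divide_1_r in H1. destruct H1 as [-> | ->]; lia.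
Qed.

Lemma same_sign_square (D1 D2 x y z e : Z) :
  0 < D1 -> 0 < D2 -> 0 < x ->
  x * x - D1 * (y * y) = 4 * e -> x * x - D2 * (z * z) = 4 * e -> e = 1 \/ e = -1 ->
  x <> 2 -> is_square (D1 * D2).
Proof.
  intros HD1 HD2 Hx E1 E2 He Hx2.
  apply (square_of_mul_square (x * x - 4 * e) (y * z)).
  (* A vanishing [y] or [z] would give [x^2 = 4 e], that is [x = 2]. *)
  - assert (y <> 0) by (intros ->; destruct He as [-> | ->]; nia).
    assert (z <> 0) by (intros ->; destruct He as [-> | ->]; nia). nia.
  - transitivity ((D1 * (y * y)) * (D2 * (z * z))); [| ring].
    f_equal; lia.
Qed.

Lemma square_of_infinite (P1 Q1 P2 Q2 : Z) :
  regular P1 Q1 -> regular P2 Q2 ->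
  infinite_Zset (fun x => inV P1 Q1 x /\ inV P2 Q2 x) -> is_square (discr P1 Q1 * discr P2 Q2).
Proof.
  intros R1 R2 Hinf. apply NNPP; intros Hns. apply Hinf.
  destruct (mixed_sign_bounded P1 Q1 P2 Q2 R1 R2) as [B1 HB1].
  destruct (mixed_sign_bounded P2 Q2 P1 Q1 R2 R1) as [B2 HB2].
  (* The value 2 is common to all sequences; [B1] and [B2] cover the two ways in which the signs can
     differ. *)
  set (B := Z.max 2 (Z.max B1 B2)).
  exists (map Z.of_nat (seq 0 (S (Z.to_nat B)))).
  intros x [[n Hn] [m Hm]].
  assert (Hx : 0 < x) by (rewrite <- Hn; now apply lucasV_bounds).
  enough (x <= B).
  { apply in_map_iff. exists (Z.to_nat x). split; [lia |]. apply in_seq. lia. }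
  pose proof (lucas_pell P1 Q1 n) as E1. pose proof (lucas_pell P2 Q2 m) as E2.
  rewrite Hn in E1. rewrite Hm in E2.
  destruct (Z.eq_dec x 2) as [-> | Hx2]; [lia |].
  pose proof (regular_sq _ _ R1) as S1. pose proof (regular_sq _ _ R2) as S2.
  pose proof (regular_discr _ _ R1) as D1. pose proof (regular_discr _ _ R2) as D2.
  (* Equal signs would make the product of the discriminants a square; opposite signs fall under the
     bounds. *)
  destruct (pow_unit_cases Q1 n S1) as [F1 | F1], (pow_unit_cases Q2 m S2) as [F2 | F2].
  - exfalso. rewrite F1 in E1. rewrite F2 in E2. apply Hns.
    apply (same_sign_square _ _ x (lucasU P1 Q1 n) (lucasU P2 Q2 m) 1); auto.
  - specialize (HB1 n m). rewrite Hn, Hm in HB1. specialize (HB1 eq_refl F1 F2). lia.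
  - specialize (HB2 m n). rewrite Hn, Hm in HB2. specialize (HB2 eq_refl F2 F1). lia.
  - exfalso. rewrite F1 in E1. rewrite F2 in E2. apply Hns.
    apply (same_sign_square _ _ x (lucasU P1 Q1 n) (lucasU P2 Q2 m) (-1)); auto.
Qed.

Theorem theorem8 (P1 Q1 P2 Q2 : Z) :
  (P1, Q1) <> (P2, Q2) ->
  ~ degenerate P1 Q1 -> ~ degenerate P2 Q2 ->
  0 < P1 -> 0 < P2 -> Z.abs Q1 = 1 -> Z.abs Q2 = 1 ->
  (infinite_Zset (fun x => inV P1 Q1 x /\ inV P2 Q2 x)
     <-> is_square (discr P1 Q1 * discr P2 Q2)) /\
  (is_square (discr P1 Q1 * discr P2 Q2) ->
     exists P' Q' : Z, 0 < P' /\ Z.abs Q' = 1 /\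
       forall x, (inV P1 Q1 x /\ inV P2 Q2 x) <-> inV P' Q' x).
Proof.
  intros _ N1 N2 HP1 HP2 HQ1 HQ2.
  pose proof (regular_of_nondegenerate P1 Q1 N1 HP1 HQ1) as R1.
  pose proof (regular_of_nondegenerate P2 Q2 N2 HP2 HQ2) as R2.
  split; [split |].
  - now apply square_of_infinite.
  - intros Hsq [l Hl].
    destruct (inV_intersection_of_square P1 Q1 P2 Q2 R1 R2 Hsq) as (i & Hi & Heq).
    apply (infinite_lucasV_subseq P1 Q1 i R1 Hi).
    exists l. intros x Hx. now apply Hl, Heq.
  - intros Hsq.
    destruct (inV_intersection_of_square P1 Q1 P2 Q2 R1 R2 Hsq) as (i & Hi & Heq).
    exists (lucasV P1 Q1 i), (Q1 ^ Z.of_nat i). split; [| split; [| exact Heq]].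
    + now apply lucasV_bounds.
    + destruct (pow_unit_cases Q1 i (regular_sq _ _ R1)) as [-> | ->]; reflexivity.
Qed.
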